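(* Let $(p,<_p)$ be a weakly o-minimal pair over a small set $A$, let $(D,<)$ be an $A$-definable linear order, and let $f:p(\mathfrak{C})\to D$ be a relatively $A$-definable non-constant function. (i) There exists a unique strictly $\subseteq$-increasing sequence $\vec E=(E_0,\dots,E_n)\in\mathcal{E}_p^{\,n+1}$ such that $E_0=\operatorname{Ker} f$ and $f$ is $((<_p)_{\vec E},<)$-increasing. (ii) There exists a $\subseteq$-increasing sequence $\vec F=(F_0,\dots,F_n)$ of $A$-definable convex equivalence relations on $(D,<)$ such that $f$ is $(<_p,<_{\vec F})$-increasing.
   Context: $T$ is a complete first-order theory (possibly multi-sorted) and $\mathfrak{C}$ is its monster model; $A$ is a small parameter set and ''definable'' means definable with parameters. For a partial type $p$ over $A$, $p(\mathfrak C)$ is its set of realizations. A subset $X\subseteq p(\mathfrak C)$ is relatively $B$-definable if $X=Y\cap p(\mathfrak C)$ for some $B$-definable set $Y$; relatively definable relations on $p(\mathfrak C)$ and relatively definable functions (via their graphs) are defined likewise. In a linear order, a set is convex if it contains every element lying between two of its elements; a convex component of a set is a maximal convex subset of it; an equivalence relation is convex if all its classes are convex. A pair $(p,<_p)$, with $p\in S(A)$ complete and $<_p$ a relatively $A$-definable linear order on $p(\mathfrak C)$, is a weakly o-minimal pair over $A$ if every relatively definable (with arbitrary parameters) subset of $p(\mathfrak C)$ has finitely many convex components in $(p(\mathfrak C),<_p)$. $\mathcal E_p$ is the set of all relatively $A$-definable equivalence relations on $p(\mathfrak C)$ (all of them are $<_p$-convex). $\operatorname{Ker} f=\{(x,x'):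 f(x)=f(x')\}$. For a linear order $(X,<)$ and a convex equivalence relation $E$ on it, define $x<_E y$ iff $(E(x,y)\wedge y<x)\vee(\neg E(x,y)\wedge x<y)$; for a sequence $\vec E=(E_1,\dots,E_n)$ of pairwise $\subseteq$-comparable convex equivalence relations, $<_{\vec E}:=(\cdots(<_{E_1})_{E_2}\cdots)_{E_n}$ (well defined). A function $g:(X,<_X)\to(Y,<_Y)$ is $(<_X,<_Y)$-increasing if $x<_X x'$ implies $g(x)\le_Y g(x')$. *)

(* Defs.v *)
From mathcomp Require Import all_boot.
From mathcomp Require Import boolp classical_sets functions cardinality.
From Stdlib Require Export Sorting.Sorted.

Set Implicit Arguments.
Unset Strict Implicit.
Unset Printing Implicit Defensive.

Local Open Scope classical_set_scope.
Local Open Scope card_scope.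

Record signature := Signature {
  Sorts : Type;
  Funs : Type;
  fdom : Funs -> seq Sorts;
  fcod : Funs -> Sorts;
  Rels : Type;
  rdom : Rels -> seq Sorts }.

(* A finite list of sorts G serves as a tuple of (de Bruijn) variables. *)
Section Syntax.
Variable L : signature.

Inductive var : seq (Sorts L) -> Sorts L -> Type :=
| VZ G s : var (s :: G) s
| VS G s s' : var G s -> var (s' :: G) s.

Inductive term (G : seq (Sorts L)) : Sorts L -> Type :=
| Var s : var G s -> term G s
| App (g : Funs L) : terms G (fdom g) -> term G (fcod g)
with terms (G : seq (Sorts L)) : seq (Sorts L) -> Type :=
| TNil : terms G [::]
| TCons s H : term G s -> terms G H -> terms G (s :: H).

Inductive formula : seq (Sorts L) -> Type :=
| Bot G : formula G
| Eq G s : term G s -> term G s -> formula G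
| Rel G (r : Rels L) : terms G (rdom r) -> formula G
| Imp G : formula G -> formula G -> formula G
| All G s : formula (s :: G) -> formula G.

Definition Neg G (phi : formula G) : formula G := Imp phi (Bot G).

End Syntax.

Fixpoint tup (S : Type) (M : S -> Type) (G : seq S) : Type :=
  if G is s :: G' then (M s * tup M G')%type else unit.

Fixpoint cat_tup (S : Type) (M : S -> Type) (G H : seq S) :
    tup M G -> tup M H -> tup M (G ++ H) :=
  match G return tup M G -> tup M H -> tup M (G ++ H) with
  | [::] => fun _ b => b
  | s :: G' => fun a b => (a.1, cat_tup a.2 b)
  end.

Fixpoint map_tup (S : Type) (M N : S -> Type) (h : forall s, M s -> N s)
    (G : seq S) : tup M G -> tup N G :=
  match G return tup M G -> tup N G with
  | [::] => fun _ => tt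
  | s :: G' => fun a => (h s a.1, map_tup h a.2)
  end.

Record structure (L : signature) := Structure {
  carrier :> Sorts L -> Type;
  inhab : forall s, inhabited (carrier s);
  fint : forall g : Funs L, tup carrier (fdom g) -> carrier (fcod g);
  rint : forall r : Rels L, set (tup carrier (rdom r)) }.

Section Semantics.
Variables (L : signature) (M : structure L).

Fixpoint get (G : seq (Sorts L)) (s : Sorts L) (v : var G s) : tup M G -> M s :=
  match v in var G s return tup M G -> M s with
  | VZ _ _ => fun a => a.1
  | VS _ _ _ v' => fun a => get v' a.2
  end.

Fixpoint teval (G : seq (Sorts L)) (a : tup M G) (s : Sorts L) (t : term G s) : M s :=
  match t in term _ s return M s with
  | Var _ v => get v a
  | App _ ts => fint (tseval a ts)
  end
with tseval (G : seq (Sorts L)) (a : tup M G) (H : seq (Sorts L))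
    (ts : terms G H) : tup M H :=
  match ts in terms _ H return tup M H with
  | TNil => tt
  | TCons _ _ t ts' => (teval a t, tseval a ts')
  end.

Fixpoint sat (G : seq (Sorts L)) (phi : formula G) : tup M G -> Prop :=
  match phi in formula G return tup M G -> Prop with
  | Bot _ => fun _ => False
  | Eq _ _ t u => fun a => teval a t = teval a u
  | Rel _ _ ts => fun a => rint (tseval a ts)
  | Imp _ phi psi => fun a => sat phi a -> sat psi a
  | All _ s phi => fun a => forall x : M s, @sat (s :: _) phi (x, a)
  end.

(* Parameter sets live in the disjoint union of the sorts. *)
Definition elt : Type := {s : Sorts L & M s}.

Definition tup_in (B : set elt) (G : seq (Sorts L)) (a : tup M G) : Prop :=
  forall s (v : var G s), B (existT _ s (get v a)).

(* A formula phi(x, b) in the variables G with parameters b from M. *)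
Record pformula (G : seq (Sorts L)) := PFormula {
  pctx : seq (Sorts L);
  pbody : formula (G ++ pctx);
  pval : tup M pctx }.

Definition psat G (phi : pformula G) (a : tup M G) : Prop :=
  sat (pbody phi) (cat_tup a (pval phi)).

Definition over (B : set elt) G (phi : pformula G) : Prop :=
  tup_in B (pval phi).

Definition pneg G (phi : pformula G) : pformula G :=
  PFormula (Neg (pbody phi)) (pval phi).

Definition realizations G (p : set (pformula G)) : set (tup M G) :=
  [set a | forall phi, p phi -> psat phi a].

Definition finitely_satisfiable G (p : set (pformula G)) : Prop :=
  forall q, finite_set q -> q `<=` p -> realizations q !=set0.

Definition partial_type (B : set elt) G (p : set (pformula G)) : Prop :=
  p `<=` over B (G := G) /\ finitely_satisfiable p.

Definition complete_type (B : set elt) G (p : set (pformula G)) : Prop :=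
  partial_type B p /\ (forall phi, over B phi -> p phi \/ p (pneg phi)).

Definition definable (B : set elt) G (X : set (tup M G)) : Prop :=
  exists2 phi : pformula G, over B phi & X = [set a | psat phi a].

Definition definable2 (B : set elt) G H (R : set (tup M G * tup M H)) : Prop :=
  exists2 Y : set (tup M (G ++ H)),
    definable B Y & R = [set z | Y (cat_tup z.1 z.2)].

Definition rel_definable (B : set elt) G (P X : set (tup M G)) : Prop :=
  exists2 Y, definable B Y & X = Y `&` P.

Definition rel_definable2 (B : set elt) G H (U R : set (tup M G * tup M H)) : Prop :=
  exists2 Y, definable2 B Y & R = Y `&` U.

Definition elementary_on (B : set elt) (h : forall s, M s -> M s) : Prop :=
  forall G (phi : formula G) (a : tup M G), tup_in B a ->
    (sat phi a <-> sat phi (map_tup h a)).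

Definition automorphism (h : forall s, M s -> M s) : Prop :=
  [/\ forall s, bijective (h s),
      forall (g : Funs L) (a : tup M (fdom g)), h _ (fint a) = fint (map_tup h a)
    & forall (r : Rels L) (a : tup M (rdom r)), rint a <-> rint (map_tup h a)].

End Semantics.

Definition theory (L : signature) : Type := set (formula (L := L) [::]).

Definition models (L : signature) (M : structure L) (T : theory L) : Prop :=
  forall phi, T phi -> @sat L M [::] phi tt.

Definition entails (L : signature) (T : theory L) (phi : formula (L := L) [::]) : Prop :=
  forall M : structure L, models M T -> @sat L M [::] phi tt.

Definition complete_theory (L : signature) (T : theory L) : Prop :=
  (exists M : structure L, models M T) /\
  (forall phi, entails T phi \/ entails T (Neg phi)).

Definition card_lt (T U : Type) (A : set T) (B : set U) : Prop :=
  A #<= B /\ ~ (B #<= A).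

(* The cardinal kappa that measures smallness is given by a type K of that
   cardinality. *)
Definition small (K : Type) (L : signature) (M : structure L) (B : set (elt M)) : Prop :=
  card_lt B [set: K].

Definition saturated (K : Type) (L : signature) (M : structure L) : Prop :=
  forall B : set (elt M), small K B ->
  forall G (p : set (pformula M G)), partial_type B p -> realizations p !=set0.

Definition strongly_homogeneous (K : Type) (L : signature) (M : structure L) : Prop :=
  forall B : set (elt M), small K B ->
  forall h : (forall s, M s -> M s), elementary_on B h ->
  exists2 g : (forall s, M s -> M s), automorphism g &
    forall s (x : M s), B (existT _ s x) -> g s x = h s x.

(* The number of formulas of L is |L| + aleph_0. *)
Definition monster (K : Type) (L : signature) (T : theory L) (C : structure L) : Prop :=
  [/\ models C T,
      card_lt [set: {G : seq (Sorts L) & formula G}] [set: K],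
      saturated K C
    & strongly_homogeneous K C].

(* Orders are strict.  Relations on a subset X of T are subsets of X `*` X. *)
Section Orders.
Variable T : Type.
Implicit Types (X K : set T) (lt E : set (T * T)).

Definition linear_order X lt : Prop :=
  [/\ lt `<=` X `*` X,
      forall x, ~ lt (x, x),
      forall x y z, lt (x, y) -> lt (y, z) -> lt (x, z)
    & forall x y, X x -> X y -> [\/ lt (x, y), x = y | lt (y, x)]].

Definition equivalence_on X E : Prop :=
  [/\ E `<=` X `*` X,
      forall x, X x -> E (x, x),
      forall x y, E (x, y) -> E (y, x)
    & forall x y z, E (x, y) -> E (y, z) -> E (x, z)].

Definition convex X lt K : Prop :=
  K `<=` X /\
  forall a z b, K a -> K b -> X z -> lt (a, z) -> lt (z, b) -> K z.

Definition convex_component X lt (Y K : set T) : Prop :=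
  [/\ convex X lt K, K `<=` Y &
      forall K', convex X lt K' -> K' `<=` Y -> K `<=` K' -> K' = K].

Definition convex_equivalence X lt E : Prop :=
  equivalence_on X E /\ forall x, X x -> convex X lt [set y | E (x, y)].

(* lt_E: the order lt reversed inside each class of E. *)
Definition flip lt E : set (T * T) :=
  [set z | (E z /\ lt (z.2, z.1)) \/ (~ E z /\ lt z)].

Definition flips lt (Es : seq (set (T * T))) : set (T * T) := foldl flip lt Es.

End Orders.

Definition increasing (T U : Type) (X : set T) (ltX : set (T * T))
    (ltY : set (U * U)) (g : T -> U) : Prop :=
  forall x x', X x -> X x' -> ltX (x, x') -> ltY (g x, g x') \/ g x = g x'.

Definition graph (T U : Type) (X : set T) (g : T -> U) : set (T * U) :=
  [set z | X z.1 /\ z.2 = g z.1].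

Definition Ker (T U : Type) (X : set T) (g : T -> U) : set (T * T) :=
  [set z | [/\ X z.1, X z.2 & g z.1 = g z.2]].

Definition weakly_ominimal_pair (L : signature) (C : structure L) (A : set (elt C))
    (G : seq (Sorts L)) (p : set (pformula C G)) (ltp : set (tup C G * tup C G)) : Prop :=
  let P := realizations p in
  [/\ complete_type A p,
      linear_order P ltp,
      rel_definable2 A (P `*` P) ltp
    & forall X, rel_definable setT P X -> finite_set (convex_component P ltp X)].

(* The set E_p of relatively A-definable equivalence relations on p(C). *)
Definition Eqv (L : signature) (C : structure L) (A : set (elt C))
    (G : seq (Sorts L)) (p : set (pformula C G)) : set (set (tup C G * tup C G)) :=
  let P := realizations p in
  [set E | equivalence_on P E /\ rel_definable2 A (P `*` P) E].

(* Main.v *)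
(* Pairs x <_p x' with f(x) <> f(x') carry a sign telling whether f preserves
   their order.  Start from E = P^2 with P = p(C).  Inside an E-class let s(x)
   be the initial segment spanned by {w | f(w) <= f(x)} (or, for the opposite
   sign, by {w | f(w) >= f(x)}).  If s(b) were strictly smaller than s(x) for
   some b > x, then by homogeneity this would happen at every x, and iterating
   it would give sets {y | f(z) <= f(y)} with arbitrarily many convex
   components, whereas their number is finite and does not depend on z.  So s
   is increasing, equality of s refines E to a convex equivalence relation E',
   and all pairs in E \ E' have the same sign.  Alternating the two signs,
   E shrinks strictly until it reaches Ker f, again by the finiteness of the
   number of components.

   Uniqueness: the relations in E_p are pairwise comparable, and the sign of a
   pair is the parity of the number of E_i containing it.

   For (ii), compactness makes E_i an equivalence relation with f-convex
   classes on a definable set containing P; F_i is generated by the convex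
   hulls in D of the images of these classes. *)
Require Import Defs.
From mathcomp Require Import all_boot.
From mathcomp Require Import boolp classical_sets functions cardinality.
Import Defs.
Local Open Scope classical_set_scope.

Set Implicit Arguments.
Unset Strict Implicit.
Unset Printing Implicit Defensive.

(** * Definable sets and substitution of variables *)

Section Tuples.
Variables (L : signature) (M : structure L).
Local Notation ctx := (seq (Sorts L)).
Local Notation tp := (tup M).
Implicit Types (G H c : ctx).

(** The motive is generalised inside the match, so that inverting the index [s :: G] leaves no
    equation between contexts to eliminate. *)
Definition var_case (s : Sorts L) G (Q : forall t, var (s :: G) t -> Prop)
    (q0 : Q s (VZ G s)) (q1 : forall t (v : var G t), Q t (VS s v)) t
    (v : var (s :: G) t) : Q t v :=
  match v in var G' t' return
    match G' return var G' t' -> Prop with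
    | [::] => fun _ => True
    | s' :: G'' => fun v' => forall Q' : (forall t, var (s' :: G'') t -> Prop),
        Q' s' (VZ G'' s') -> (forall t (u : var G'' t), Q' t (VS s' u)) -> Q' t' v'
    end v with
  | VZ _ _ => fun _ q0' _ => q0'
  | VS _ _ _ u => fun _ _ q1' => q1' _ u
  end Q q0 q1.

Lemma tup_ext G (a b : tp G) :
  (forall s (v : var G s), get v a = get v b) -> a = b.
Proof.
elim: G a b => [|s G IH] /=; first by case; case.
case=> a1 a2 [b1 b2] e; congr pair; first exact: (e s (VZ G s)).
by apply: IH => t v; exact: (e t (VS s v)).
Qed.

Fixpoint tleft G H : tp (G ++ H) -> tp G :=
  match G return tp (G ++ H) -> tp G with
  | [::] => fun _ => tt
  | s :: G' => fun a => (a.1, @tleft G' H a.2)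
  end.

Fixpoint tright G H : tp (G ++ H) -> tp H :=
  match G return tp (G ++ H) -> tp H with
  | [::] => fun a => a
  | s :: G' => fun a => @tright G' H a.2
  end.

Lemma tleft_cat G H (a : tp G) (b : tp H) : tleft (cat_tup a b) = a.
Proof. by elim: G a => [|s G IH] /=; [case | case=> x a /=; rewrite IH]. Qed.

Lemma tright_cat G H (a : tp G) (b : tp H) : tright (cat_tup a b) = b.
Proof. by elim: G a => [|s G IH] //= [x a] /=; rewrite IH. Qed.

Lemma cat_left_right G H (a : tp (G ++ H)) : cat_tup (tleft a) (tright a) = a.
Proof. by elim: G a => [|s G IH] //= [x a] /=; rewrite IH. Qed.

(** Substitutions of variables are given by their action on tuples, each coordinate of [m a] being a
    fixed coordinate of [a]. Regrouping concatenated tuples then needs no transport between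
    contexts. *)
Definition renaming G G' (m : tp G' -> tp G) : Prop :=
  forall s (v : var G s), exists v' : var G' s, forall a, get v (m a) = get v' a.

Lemma renaming_id G : renaming (@id (tp G)).
Proof. by move=> s v; exists v. Qed.

Lemma renaming_comp G1 G2 G3 (m : tp G2 -> tp G1) (n : tp G3 -> tp G2) :
  renaming m -> renaming n -> renaming (fun a => m (n a)).
Proof.
move=> hm hn s v; have [v1 e1] := hm _ v; have [v2 e2] := hn _ v1.
by exists v2 => a; rewrite e1 e2.
Qed.

Lemma var_nil (s : Sorts L) : var [::] s -> False.
Proof. by move eG : [::] => G0 v; case: v eG. Qed.

Lemma renaming_nil G' : renaming (fun _ : tp G' => (tt : tp [::])).
Proof. by move=> s v; case: (var_nil v). Qed.

Lemma renaming_cons G G' s (h : tp G' -> M s) (m : tp G' -> tp G) :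
  (exists v : var G' s, forall a, h a = get v a) -> renaming m ->
  renaming (fun a => (h a, m a) : tp (s :: G)).
Proof. by move=> hh hm t v; move: t v; apply: var_case. Qed.

Lemma renaming_tail G s : renaming (fun a : tp (s :: G) => (a.2 : tp G)).
Proof. by move=> t v; exists (VS s v). Qed.

Lemma renaming_left G H : renaming (@tleft G H).
Proof.
elim: G => [|s G IH] /=; first exact: renaming_nil.
apply: renaming_cons; first by exists (VZ _ s).
exact: renaming_comp IH (@renaming_tail _ s).
Qed.

Lemma renaming_right G H : renaming (@tright G H).
Proof.
elim: G => [|s G IH] /=; first exact: renaming_id.
exact: renaming_comp IH (@renaming_tail _ s).
Qed.

Lemma get_cat G H s (v : var (G ++ H) s) :
  (exists u : var G s, forall (a : tp G) (b : tp H), get v (cat_tup a b) = get u a) \/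
  (exists u : var H s, forall (a : tp G) (b : tp H), get v (cat_tup a b) = get u b).
Proof.
elim: G v => [|s' G IH] /=; first by move=> v; right; exists v.
move=> v; move: s v IH; apply: var_case.
  by move=> _; left; exists (VZ G s').
move=> t v /(_ v) [[u e]|[u e]]; first by left; exists (VS s' u) => a b /=.
by right; exists u => a b /=.
Qed.

Lemma renaming_cat G H G' (m : tp G' -> tp G) (n : tp G' -> tp H) :
  renaming m -> renaming n -> renaming (fun a => cat_tup (m a) (n a)).
Proof.
move=> hm hn s v; case: (get_cat v) => -[u e].
  by have [v' e'] := hm _ u; exists v' => a; rewrite e e'.
by have [v' e'] := hn _ u; exists v' => a; rewrite e e'.
Qed.

Scheme term_mind := Induction for term Sort Prop
with terms_mind := Induction for terms Sort Prop.
Combined Scheme term_terms_ind from term_mind, terms_mind.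

Lemma rename_term G G' (m : tp G' -> tp G) : renaming m ->
  (forall s (t : term G s), exists t' : term G' s, forall a, teval a t' = teval (m a) t) /\
  (forall H (ts : terms G H),
     exists ts' : terms G' H, forall a, tseval a ts' = tseval (m a) ts).
Proof.
move=> hm; apply: term_terms_ind.
- by move=> s v; have [v' e] := hm _ v; exists (Var v') => a /=.
- by move=> g ts [ts' e]; exists (App ts') => a /=; rewrite e.
- by exists (TNil _).
- by move=> s H t [t' e] ts [ts' e']; exists (TCons t' ts') => a /=; rewrite e e'.
Qed.

Lemma rename_formula G (phi : formula G) G' (m : tp G' -> tp G) : renaming m ->
  exists phi' : formula G', forall a, sat phi' a <-> sat phi (m a).
Proof.
elim: phi G' m => {G}.
- by move=> G G' m _; exists (Bot _).
- move=> G s t u G' m hm; have [[t' et] [u' eu]] :=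
    ((rename_term hm).1 _ t, (rename_term hm).1 _ u).
  by exists (Eq t' u') => a /=; rewrite et eu.
- move=> G r ts G' m hm; have [ts' e] := (rename_term hm).2 _ ts.
  by exists (Rel ts') => a /=; rewrite e.
- move=> G phi IH1 psi IH2 G' m hm.
  have [phi' e1] := IH1 _ _ hm; have [psi' e2] := IH2 _ _ hm.
  by exists (Imp phi' psi') => a /=; rewrite e1 e2.
- move=> G s phi IH G' m hm.
  have [|phi' e] := IH (s :: G') (fun a => (a.1, m a.2)).
    apply: renaming_cons; first by exists (VZ _ s).
    exact: renaming_comp hm (@renaming_tail _ _).
  by exists (All phi') => a /=; split=> h x; have := h x; rewrite e.
Qed.

Section MapTuple.
Variable h : forall s, M s -> M s.

Lemma get_map G s (v : var G s) (a : tp G) : get v (map_tup h a) = h (get v a).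
Proof. by elim: v a => //= *. Qed.

Lemma map_cat G H (a : tp G) (b : tp H) :
  map_tup h (cat_tup a b) = cat_tup (map_tup h a) (map_tup h b).
Proof. by elim: G a => [|s G IH] //= [x a] /=; rewrite IH. Qed.

Hypothesis hh : automorphism h.

Lemma map_surj G (a : tp G) : exists b, map_tup h b = a.
Proof.
have [hb _ _] := hh; elim: G a => [|s G IH] /=; first by case; exists tt.
move=> [x a]; have [b <-] := IH a; have [k _ kK] := hb s.
by exists (k x, b) => /=; rewrite kK.
Qed.

Lemma teval_map G (a : tp G) :
  (forall s (t : term G s), teval (map_tup h a) t = h (teval a t)) /\
  (forall H (ts : terms G H), tseval (map_tup h a) ts = map_tup h (tseval a ts)).
Proof.
have [_ hf _] := hh; apply: term_terms_ind => /=.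
- by move=> s v; rewrite get_map.
- by move=> g ts ->; rewrite hf.
- by [].
- by move=> s H t -> ts ->.
Qed.

Lemma sat_map G (phi : formula G) (a : tp G) : sat phi (map_tup h a) <-> sat phi a.
Proof.
have [hb _ hr] := hh; elim: phi a => {G} /=.
- by [].
- move=> G s t u a; rewrite !(teval_map a).1; split=> [|->//].
  exact: (bij_inj (hb s)).
- by move=> G r ts a; rewrite (teval_map a).2 -hr.
- by move=> G phi IH1 psi IH2 a; rewrite IH1 IH2.
- move=> G s phi IH a; have [k kK hK] := hb s.
  split=> H x; first by rewrite -IH /=; exact: H.
  by rewrite -(hK x); have /(iffRL (IH (k x, a))) := H (k x).
Qed.

End MapTuple.
End Tuples.

(** * Closure properties of definable sets and relations *)

Section Definability.
Variables (L : signature) (M : structure L).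
Local Notation ctx := (seq (Sorts L)).
Local Notation tp := (tup M).
Implicit Types (G H c : ctx) (A B : set (elt M)).

Definition entries G (a : tp G) : set (elt M) :=
  [set e | exists s (v : var G s), e = existT _ s (get v a)].

Lemma tup_in_cat B G H (a : tp G) (b : tp H) :
  tup_in B a -> tup_in B b -> tup_in B (cat_tup a b).
Proof. by move=> ha hb s v; case: (get_cat M v) => -[u ->]. Qed.

Lemma definableS A B G (X : set (tp G)) : A `<=` B -> definable A X -> definable B X.
Proof. by move=> AB [phi hp ->]; exists phi => // s v; apply/AB/hp. Qed.

Lemma definable_rename B G G' (m : tp G' -> tp G) (X : set (tp G)) :
  renaming m -> definable B X -> definable B [set a | X (m a)].
Proof.
move=> hm [[c phi b] hb ->].
have [|phi' e] := @rename_formula _ M _ phi (G' ++ c) (fun d => cat_tup (m (tleft d)) (tright d)).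
  apply: renaming_cat; first exact: renaming_comp hm (@renaming_left _ _ _ _).
  exact: renaming_right.
exists (PFormula phi' b) => //; apply/seteqP; split=> a /=;
  by rewrite /psat /= e tleft_cat tright_cat.
Qed.

Lemma definable_not B G (X : set (tp G)) : definable B X -> definable B [set a | ~ X a].
Proof. by move=> [phi hb ->]; exists (pneg phi). Qed.

Lemma definable_imp B G (X Y : set (tp G)) :
  definable B X -> definable B Y -> definable B [set a | X a -> Y a].
Proof.
move=> [[c phi b] hb ->] [[c' psi b'] hb' ->].
have [|phi' e] := @rename_formula _ M _ phi (G ++ (c ++ c'))
  (fun d => cat_tup (tleft d) (tleft (tright d))).
  apply: renaming_cat; first exact: renaming_left.
  exact: renaming_comp (@renaming_left _ _ _ _) (@renaming_right _ _ _ _).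
have [|psi' e'] := @rename_formula _ M _ psi (G ++ (c ++ c'))
  (fun d => cat_tup (tleft d) (tright (tright d))).
  apply: renaming_cat; first exact: renaming_left.
  exact: renaming_comp (@renaming_right _ _ _ _) (@renaming_right _ _ _ _).
exists (PFormula (Imp phi' psi') (cat_tup b b')).
  exact: tup_in_cat.
by apply/seteqP; split=> a /=;
  rewrite /psat /= e e' tleft_cat !tright_cat tleft_cat.
Qed.

Lemma definable_and B G (X Y : set (tp G)) :
  definable B X -> definable B Y -> definable B [set a | X a /\ Y a].
Proof.
move=> hX hY.
have := definable_not (definable_imp hX (definable_not hY)).
congr definable; apply/seteqP; split=> a /=; last by case=> ? ? /(_ _) [].
by move=> h; split; apply: contrapT => h'; apply: h => // ? ?.
Qed.

Lemma definable_or B G (X Y : set (tp G)) :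
  definable B X -> definable B Y -> definable B [set a | X a \/ Y a].
Proof.
move=> hX hY.
have := definable_imp (definable_not hX) hY.
congr definable; apply/seteqP; split=> a /=; last by case.
by move=> h; case: (pselect (X a)) => [?|/h ?]; [left | right].
Qed.

Lemma definable_true B G : definable B [set _ : tp G | True].
Proof.
exists (@PFormula _ M G [::] (Imp (Bot _) (Bot _)) tt).
  by move=> s0 w0; case: (var_nil w0).
by apply/seteqP; split=> a // _; rewrite /psat /=.
Qed.

Lemma definable_all1 B G s (X : set (tp (s :: G))) :
  definable B X -> definable B [set a | forall x : M s, X (x, a)].
Proof.
by move=> [[c phi b] hb ->]; exists (PFormula (All (phi : formula (s :: (G ++ c)))) b).
Qed.

Lemma definable_all B G H (X : set (tp (H ++ G))) :
  definable B X -> definable B [set a | forall h : tp H, X (cat_tup h a)].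
Proof.
elim: H X => [|s H IH] X hX /=.
  by move: hX; congr definable; apply/seteqP; split=> a /= h //; exact: (h tt).
have := IH _ (definable_all1 hX); congr definable; apply/seteqP; split=> a /= h.
  by case=> x y; exact: h.
by move=> y x; exact: (h (x, y)).
Qed.

(** [Q] takes the two blocks of variables separately, so that an existential inside a set written
    with [tleft] and [tright] can be matched directly. *)
Lemma definable_ex B G H (Q : tp H -> tp G -> Prop) :
  definable B [set d : tp (H ++ G) | Q (tleft d) (tright d)] ->
  definable B [set a | exists h, Q h a].
Proof.
move/definable_not/definable_all/definable_not; congr definable.
apply/seteqP; split=> a /=; last first.
  by case=> h Q1 /(_ h); rewrite tleft_cat tright_cat.
move=> h; apply: contrapT => h'; apply: h => k; rewrite tleft_cat tright_cat => ?.
by apply: h'; exists k.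
Qed.

Lemma definable_plug B G H (X : set (tp (G ++ H))) (h : tp H) :
  tup_in B h -> definable B X -> definable B [set a | X (cat_tup a h)].
Proof.
move=> hh [[c phi b] hb ->].
have [|phi' e] := @rename_formula _ M _ phi (G ++ (H ++ c))
  (fun d => cat_tup (cat_tup (tleft d) (tleft (tright d))) (tright (tright d))).
  apply: renaming_cat; last exact: renaming_comp (@renaming_right _ _ _ _) (@renaming_right _ _ _ _).
  apply: renaming_cat; first exact: renaming_left.
  exact: renaming_comp (@renaming_left _ _ _ _) (@renaming_right _ _ _ _).
exists (PFormula phi' (cat_tup h b)); first exact: tup_in_cat.
by apply/seteqP; split=> a /=;
  rewrite /psat /= e tleft_cat !tright_cat tleft_cat.
Qed.

Lemma definable_get B G s (v w : var G s) : definable B [set a : tp G | get v a = get w a].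
Proof.
have [v' ev] := @renaming_left _ M G [::] _ v.
have [w' ew] := @renaming_left _ M G [::] _ w.
exists (@PFormula _ M G [::] (Eq (Var v') (Var w')) tt).
  by move=> s0 w0; case: (var_nil w0).
by apply/seteqP; split=> a; rewrite /psat /= -ev -ew tleft_cat.
Qed.

Lemma definable_get_cst B G s (v : var G s) (x : M s) : B (existT _ s x) ->
  definable B [set a : tp G | get v a = x].
Proof.
move=> Bx; have [v' ev] := @renaming_left _ M G [:: s] _ v.
have [w' ew] := @renaming_right _ M G [:: s] _ (VZ [::] s).
exists (@PFormula _ M G [:: s] (Eq (Var v') (Var w')) (x, tt)).
  move=> t w; move: t w; apply: var_case => // t w.
  by case: (var_nil w).
by apply/seteqP; split=> a; rewrite /psat /= -ev -ew tleft_cat tright_cat.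
Qed.

Definition definable_rel B G H (R : tp G -> tp H -> Prop) : Prop :=
  definable B [set d : tp (G ++ H) | R (tleft d) (tright d)].

Lemma definable_relP B G H (R : tp G -> tp H -> Prop) :
  definable_rel B R -> definable2 B [set z | R z.1 z.2].
Proof.
move=> hR; eexists; first exact: hR.
by apply/seteqP; split=> -[x y] /=; rewrite tleft_cat tright_cat.
Qed.

Lemma definable2P B G H (R : set (tp G * tp H)) :
  definable2 B R -> definable_rel B (fun x y => R (x, y)).
Proof.
move=> [Y hY ->]; move: hY; congr definable.
by apply/seteqP; split=> d /=; rewrite cat_left_right.
Qed.

Lemma definable_rel_comp B G H G' (R : tp G -> tp H -> Prop)
    (m : tp G' -> tp G) (n : tp G' -> tp H) :
  renaming m -> renaming n -> definable_rel B R -> definable B [set a | R (m a) (n a)].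
Proof.
move=> hm hn /(definable_rename (renaming_cat hm hn)); congr definable.
by apply/seteqP; split=> d /=; rewrite tleft_cat tright_cat.
Qed.

Lemma definable_eq B G G' (m n : tp G' -> tp G) :
  renaming m -> renaming n -> definable B [set a | m a = n a].
Proof.
elim: G m n => [|s G IH] m n hm hn.
  have := @definable_true B G'; congr definable; apply/seteqP; split=> a //= _.
  by case: (m a) (n a) => -[].
have [v ev] := hm _ (VZ _ s); have [w ew] := hn _ (VZ _ s).
have h1 := @definable_get B _ _ v w.
have h2 := IH _ _ (renaming_comp (@renaming_tail _ M G s) hm)
                  (renaming_comp (@renaming_tail _ M G s) hn).
have := definable_and h1 h2; congr definable; apply/seteqP; split=> a /=.
  by rewrite -ev -ew /= => -[]; case: (m a) (n a) => ? ? [? ?] /= -> ->.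
by rewrite -ev -ew => ->.
Qed.

Lemma definable_section B G H (R : tp G -> tp H -> Prop) (x : tp G) :
  tup_in B x -> definable_rel B R -> definable B (R x).
Proof.
move=> hx hR.
have := definable_rename (renaming_cat (@renaming_right _ M H G) (@renaming_left _ M H G)) hR.
move/(definable_plug hx); congr definable.
by apply/seteqP; split=> y /=; rewrite !tleft_cat !tright_cat.
Qed.

Lemma definable_aut A (h : forall s, M s -> M s) G (X : set (tp G)) (a : tp G) :
  automorphism h -> (forall s (x : M s), A (existT _ s x) -> h s x = x) ->
  definable A X -> X (map_tup h a) <-> X a.
Proof.
move=> hh hA [[c phi b] hb ->] /=; rewrite /psat /=.
suff e : map_tup h b = b by rewrite -{1}e -map_cat sat_map.
by apply: tup_ext => s v; rewrite get_map; apply/hA/hb.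
Qed.

End Definability.

(** * Compactness and homogeneity *)

Section Smallness.
Open Scope card_scope.

(** Hilbert's hotel along a copy [j] of the natural numbers inside [A]: [x] goes to [j 0], each
    [j n] to [j n.+1], and all other points stay. *)
Lemma card_le_setU1 T (A : set T) (x : T) : infinite_set A -> x |` A #<= A.
Proof.
elim/Ppointed: T => T in A x *; first by have := no x.
move=> /infiniteP /pcard_leP /injfunPex [j jA jinj].
case: (pselect (A x)) => [Ax|nAx].
  by apply: subset_card_le => y [->|].
have jx n : j n <> x by move=> e; apply: nAx; rewrite -e; exact: jA.
have jI m n : j m = j n -> m = n by apply: jinj; rewrite inE.
have /choice [g gE] : forall y, exists z, [\/ y = x /\ z = j 0,
    exists2 n, y = j n & z = j n.+1 | [/\ y <> x, forall n, y <> j n & z = y]].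
  move=> y; case: (pselect (y = x)) => [->|yx]; first by exists (j 0); constructor 1.
  case: (pselect (exists n, y = j n)) => [[n ->]|h].
    by exists (j n.+1); constructor 2; exists n.
  by exists y; constructor 3; split=> // n e; apply: h; exists n.
apply/pcard_leP/injfunPex; exists g.
  move=> y Uy; case: (gE y) => [[_ ->]|[n _ ->]|[yx _ ->]]; try exact: jA.
  by case: Uy.
move=> y z _ _; case: (gE y) => [[-> ->]|[n -> ->]|[yx yj ->]];
  case: (gE z) => [[-> ->]|[m -> ->]|[zx zj ->]] //.
- by move/jI.
- by move=> /esym /zj.
- by move/jI.
- by move/jI => [->].
- by move=> /esym /zj.
- by move/yj.
- by move/yj.
Qed.

Variables (L : signature) (M : structure L) (K : Type).
Hypothesis hK : infinite_set [set: K].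

Lemma small_setU1 (B : set (elt M)) x : small K B -> small K (x |` B).
Proof.
move=> [BK KB]; case: (pselect (finite_set B)) => [fB|iB].
  have fx : finite_set (x |` B) by rewrite finite_setU; split=> //; exact: finite_set1.
  split; last by move=> /card_le_finite /(_ fx).
  have /finite_setP [n] := fx; rewrite card_eq_le => /andP[h _].
  apply: card_le_trans h _; apply: card_le_trans (_ : _ #<= [set: nat]) _.
    exact: subset_card_le.
  exact/infiniteP.
have xB := card_le_setU1 x iB.
by split=> [|/card_le_trans /(_ xB)//]; exact: card_le_trans xB BK.
Qed.

Lemma small_entries (B : set (elt M)) G (a : tup M G) :
  small K B -> small K (entries a `|` B).
Proof.
move=> sB; elim: G a => [|s G IH] a.
  suff -> : entries a `|` B = B by [].
  apply/seteqP; split=> x; last by right.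
  by case=> // -[s0 [v _]]; case: (var_nil v).
case: a => y a; have := small_setU1 (existT _ s y) (IH a).
congr small; apply/seteqP; split=> x.
  case=> [->|[[t [v ->]]|]]; last by right.
    by left; exists s, (VZ G s).
  by left; exists t, (VS s v).
case=> [[t [v ->]]|]; last by right; right.
move: t v; apply: var_case; first by left.
by move=> t v; right; left; exists t, v.
Qed.

End Smallness.

Lemma tup_in_entries L (M : structure L) (B : set (elt M)) G (a : tup M G) :
  tup_in (entries a `|` B) a.
Proof. by move=> s v; left; exists s, v. Qed.

Lemma entriesP L (M : structure L) G (a : tup M G) (z : elt M) :
  entries a z -> exists v : var G (projT1 z), get v a = projT2 z.
Proof. by case=> s [v ->]; exists v. Qed.

(** [K] exceeds the number of formulas, and the iterated negations of falsity are already infinitely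
    many. *)
Lemma monster_infinite K L (T : theory L) (C : structure L) :
  monster K T C -> infinite_set [set: K].
Proof.
move=> [_ [h _] _ _]; apply/infiniteP; apply: card_le_trans h.
pose F n : {G : seq (Sorts L) & formula G} :=
  existT _ [::] (iter n (@Neg L [::]) (Bot [::])).
suff FI : injective F.
  suff [f] : $|{injfun [set: nat] >-> [set: {G : seq (Sorts L) & formula G}]}|.
    exact: inj_card_le f.
  by apply/injfunPex; exists F => // x y _ _ /FI.
(* Descending through premises of implications counts the negations in [F n], which makes [F]
   injective. *)
pose depth := fix d G (phi : formula (L := L) G) : nat :=
  match phi with Imp _ psi _ => (d _ psi).+1 | _ => 0 end.
pose dp (z : {G : seq (Sorts L) & formula G}) := depth _ (projT2 z).
have dF n : dp (F n) = n by rewrite /dp /F /=; elim: n => //= n ->.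
by move=> m n /(congr1 dp); rewrite !dF.
Qed.

Section Monster.
Variables (L : signature) (K : Type) (C : structure L).
Hypothesis hK : infinite_set [set: K].
Hypothesis hsat : saturated K C.
Hypothesis hhom : strongly_homogeneous K C.
Variables (A : set (elt C)) (G : seq (Sorts L)) (p : set (pformula C G)).
Hypothesis hA : small K A.
Hypothesis hp : complete_type A p.
Local Notation P := (realizations p).
Local Notation tp := (tup C).

Lemma type_complete X x : definable A X -> P x -> X x -> P `<=` X.
Proof.
have [_ hc] := hp; move=> [phi hphi ->] Px Xx y Py.
case: (hc phi hphi) => h; first exact: Py.
by have := Px _ h Xx.
Qed.

Lemma type_aut (h : forall s, C s -> C s) x : automorphism h ->
  (forall s (x : C s), A (existT _ s x) -> h s x = x) ->
  P (map_tup h x) <-> P x.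
Proof.
move=> hh hfix; have [[h1 _] _] := hp.
have e phi : p phi -> psat phi (map_tup h x) <-> psat phi x.
  move=> pphi; apply: (@definable_aut _ _ A h G (psat phi) x hh hfix).
  by exists phi => //; exact: h1.
by split=> Px phi pphi; move: (Px phi pphi); rewrite e.
Qed.

(** If every [A]-definable set containing [P] had a triple violating [Z], saturation would give one
    violating triple lying in all these sets, hence in [P]. Three variables are what transitivity
    and convexity conditions require. *)
Lemma compactness (B : set (elt C)) (Z : tp G -> tp G -> tp G -> Prop) :
  small K B -> A `<=` B ->
  definable B [set d : tp (G ++ (G ++ G)) |
    Z (tleft d) (tleft (tright d)) (tright (tright d))] ->
  (forall x y z, P x -> P y -> P z -> Z x y z) ->
  exists X, [/\ definable A X, P `<=` X &
    forall x y z, X x -> X y -> X z -> Z x y z].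
Proof.
move=> sB AB dZ hZ; apply: contrapT => hn.
have neg X : definable A X -> P `<=` X ->
    exists d : tp (G ++ (G ++ G)), [/\ X (tleft d), X (tleft (tright d)),
      X (tright (tright d)) & ~ Z (tleft d) (tleft (tright d)) (tright (tright d))].
  move=> dX PX; apply: contrapT => h; apply: hn; exists X; split=> // x y z Xx Xy Xz.
  apply: contrapT => nZ; apply: h; exists (cat_tup x (cat_tup y z)).
  by rewrite !(tleft_cat, tright_cat).
(* [q] collects all consequences over [B] of a violation of [Z] inside some [X]. Defining it through
   consequences avoids writing any formula explicitly. *)
pose q : set (pformula C (G ++ (G ++ G))) := [set phi | over B phi /\
  exists X, [/\ definable A X, P `<=` X & forall d, X (tleft d) ->
    X (tleft (tright d)) -> X (tright (tright d)) ->
    ~ Z (tleft d) (tleft (tright d)) (tright (tright d)) -> psat phi d]].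
have pq : partial_type B q.
  split=> [phi []//|q0 /finite_setP [n]].
  rewrite card_eq_le => /andP[/pcard_leP /injfunPex [g gn ginj] _] q0q.
  suff [X [dX PX hX]] : exists X, [/\ definable A X, P `<=` X &
      forall phi, q0 phi -> g phi < n -> forall d, X (tleft d) -> X (tleft (tright d)) ->
        X (tright (tright d)) ->
      ~ Z (tleft d) (tleft (tright d)) (tright (tright d)) -> psat phi d].
    have [d [h1 h2 h3 h4]] := neg X dX PX.
    by exists d => phi q0phi; apply: hX => //; exact: gn.
  (* Following the numbering [g] of the finite set [q0], the sets [X] serving single formulas are
     intersected into one that serves them all. *)
  elim: (n) => [|m [X [dX PX hX]]].
    by exists setT; split=> //; exact: definable_true.
  case: (pselect (exists2 phi, q0 phi & g phi = m)) => [[phi q0phi gphi]|nm].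
    have [_ [Y [dY PY hY]]] := q0q _ q0phi.
    exists (X `&` Y); split; first exact: definable_and.
      by move=> x Px; split; [exact: PX | exact: PY].
    move=> psi q0psi; rewrite ltnS leq_eqVlt => /orP[/eqP gpsi|lt] d [? ?] [? ?] [? ?];
      last exact: hX.
    suff <- : phi = psi by exact: hY.
    by apply: ginj; rewrite ?inE // gphi.
  exists X; split=> // psi q0psi; rewrite ltnS leq_eqVlt => /orP[/eqP gpsi|]; last exact: hX.
  by case: nm; exists psi.
have [d dq] := hsat sB pq.
have key Y : definable B Y -> (exists X, [/\ definable A X, P `<=` X & forall d, X (tleft d) ->
    X (tleft (tright d)) -> X (tright (tright d)) ->
    ~ Z (tleft d) (tleft (tright d)) (tright (tright d)) -> Y d]) -> Y d.
  by move=> [phi hphi ->] hX; apply: dq.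
have [[pA _] _] := hp.
have inP m : renaming m -> (forall X : set (tp G), definable A X -> P `<=` X ->
    forall d, X (tleft d) -> X (tleft (tright d)) -> X (tright (tright d)) -> X (m d)) ->
    P (m d).
  move=> hm hX phi pphi.
  have dphi : definable A (psat phi) by exists phi => //; exact: pA.
  have Pphi : P `<=` psat phi by move=> x; apply.
  suff : [set d | psat phi (m d)] d by [].
  apply: key; first exact: definableS AB (definable_rename hm dphi).
  by exists (psat phi); split=> // d' ? ? ? _; exact: (hX _ dphi Pphi).
suff : ~ Z (tleft d) (tleft (tright d)) (tright (tright d)).
  apply; apply: hZ.
  - by apply: (inP (@tleft _ C G (G ++ G))) => //; exact: renaming_left.
  - apply: (inP (fun d => tleft (@tright _ C G (G ++ G) d))) => //.
    exact: renaming_comp (@renaming_left _ _ _ _) (@renaming_right _ _ _ _).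
  - apply: (inP (fun d => tright (@tright _ C G (G ++ G) d))) => //.
    exact: renaming_comp (@renaming_right _ _ _ _) (@renaming_right _ _ _ _).
suff : [set d | ~ Z (tleft d) (tleft (tright d)) (tright (tright d))] d by [].
apply: key; first exact: definable_not.
by exists setT; split=> //; exact: definable_true.
Qed.

(* A tuple from A and the entries of x is a renaming of (x, b) with b in A;
   the map moving x to x' acts on it by replacing x with x'. *)
Lemma type_homogeneous x x' : P x -> P x' ->
  exists h : forall s, C s -> C s,
    [/\ automorphism h, forall s (y : C s), A (existT _ s y) -> h s y = y
      & map_tup h x = x'].
Proof.
move=> Px Px'.
have tpE X : definable A X -> X x -> X x'.
  by move=> dX Xx; exact: (type_complete dX Px Xx).
have ex s (y : C s) : exists z : C s,
    (exists2 v : var G s, get v x = y & get v x' = z) \/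
    ((forall v : var G s, get v x <> y) /\ z = y).
  case: (pselect (exists v : var G s, get v x = y)) => [[v e]|nv].
    by exists (get v x'); left; exists v.
  by exists y; right; split=> // v e; apply: nv; exists v.
pose h s y := projT1 (cid (ex s y)).
have hE s y : (exists2 v : var G s, get v x = y & get v x' = h s y) \/
    ((forall v : var G s, get v x <> y) /\ h s y = y) := projT2 (cid (ex s y)).
(* Coincidences among the entries of [x], and between these and elements of [A], are expressed over
   [A]. Hence [x'] has the same ones, and the position chosen for a repeated entry is immaterial. *)
have hx s (v : var G s) : h s (get v x) = get v x'.
  case: (hE s (get v x)) => [[w e <-]|[/(_ v)] //].
  exact: (tpE _ (definable_get A w v) e).
have hAA s (y : C s) : A (existT _ s y) -> h s y = y.
  move=> Ay; case: (hE s y) => [[w e <-]|[] //].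
  exact: (tpE _ (definable_get_cst w Ay) e).
have split_tup G' (a : tp G') : tup_in (entries x `|` A) a ->
    exists c (b : tp c) (m : tp (G ++ c) -> tp G'),
    [/\ tup_in A b, renaming m, a = m (cat_tup x b) & map_tup h a = m (cat_tup x' b)].
  elim: G' a => [|s G' IH] /=.
    move=> a _; exists [::], tt, (fun=> tt); split=> //; try by case: a.
      by move=> s v; case: (var_nil v).
    exact: renaming_nil.
  case=> y a ha; have [|c [b [m [hb hm e1 e2]]]] := IH a.
    by move=> t v; exact: (ha t (VS s v)).
  case: (hE s y) => [[v ev ev']|[nv hy]].
    have [w hw] := @renaming_left _ C G c _ v.
    exists c, b, (fun d => (get w d, m d)); split=> //.
    - by apply: renaming_cons => //; exists w.
    - by rewrite -hw tleft_cat ev -e1.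
    - by rewrite -hw tleft_cat ev' -e2.
  have Ay : A (existT _ s y).
    by case: (ha s (VZ G' s)) => //= /entriesP [v] /= /nv.
  pose r (d : tp (G ++ s :: c)) : tp (s :: c) := tright d.
  pose b' : tp (s :: c) := (y, b).
  exists (s :: c), b', (fun d => ((r d).1, m (cat_tup (tleft d) (r d).2))).
  split.
  - by move=> t v; move: t v; apply: var_case.
  - apply: renaming_cons.
      have [w hw] := @renaming_right _ C G (s :: c) _ (VZ c s).
      by exists w => d; rewrite -hw.
    apply: renaming_comp hm _; apply: renaming_cat; first exact: renaming_left.
    exact: renaming_comp (@renaming_tail _ C c s) (@renaming_right _ C G (s :: c)).
  - by rewrite /r tright_cat tleft_cat -e1.
  - by rewrite /r tright_cat tleft_cat -e2 /= hy.
have elem : elementary_on (entries x `|` A) h.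
  move=> G' phi a /split_tup [c [b [m [hb hm -> ->]]]].
  have [phi' e] := rename_formula phi hm; rewrite -!e.
  have dphi : definable A (psat (PFormula phi' b)) by exists (PFormula phi' b).
  have dphi' := definable_not dphi.
  split=> [|h']; first exact: (tpE _ dphi).
  by apply: contrapT => n; exact: (tpE _ dphi' n).
have [g hg gh] := hhom (small_entries hK x hA) elem.
exists g; split=> //.
  by move=> s y Ay; rewrite gh ?hAA //; right.
apply: tup_ext => s v; rewrite get_map gh ?hx //.
by left; exists s, v.
Qed.
End Monster.

(** * Chains of equivalence relations *)

Section Parity.
Variable T : Type.
Implicit Types (E F K : set (T * T)) (Es L : seq (set (T * T))).

Definition parity Es (z : T * T) : bool := foldr (fun E b => `[< E z >] (+) b) false Es.

Definition symmetric_rel E := forall x y, E (x, y) -> E (y, x).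

Lemma parity_sym Es x y : List.Forall symmetric_rel Es -> parity Es (x, y) = parity Es (y, x).
Proof.
by elim=> //= E Es' sE _ ->; congr (_ (+) _); apply/asbool_equiv_eq; split; exact: sE.
Qed.

(** A pair is reversed once by each relation that contains it; by symmetry the reversed pair lies in
    the same relations, so only the parity of the count remains. *)
Lemma flips_parity (lt : set (T * T)) Es x y : List.Forall symmetric_rel Es ->
  flips lt Es (x, y) <-> if parity Es (x, y) then lt (y, x) else lt (x, y).
Proof.
move=> sEs; elim: sEs lt => //= E Es' sE _ IH lt; rewrite IH /flip /=.
case: (pselect (E (x, y))) => xy.
  have yx := sE _ _ xy; rewrite asboolT // addTb.
  by case: (parity _ _) => /=; split=> [[[]|[]] //|?]; left.
have yx : ~ E (y, x) by move/sE.
rewrite asboolF // addFb.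
by case: (parity _ _) => /=; split=> [[[]|[]] //|?]; right.
Qed.

Lemma increasing_parity U P (lt : set (T * T)) (ltU : set (U * U)) (g : T -> U) Es :
  List.Forall symmetric_rel Es ->
  increasing P (flips lt Es) ltU g <->
  forall x y, P x -> P y -> lt (x, y) ->
    if parity Es (x, y) then ltU (g y, g x) \/ g y = g x else ltU (g x, g y) \/ g x = g y.
Proof.
move=> sEs; split=> h x y Px Py.
  move=> xy; case e: (parity _ _); apply: h => //; apply/flips_parity => //.
    by rewrite -parity_sym // e.
  by rewrite e.
move/flips_parity => /(_ sEs); case e: (parity _ _) => xy.
  by have := h y x Py Px xy; rewrite parity_sym // e.
by have := h x y Px Py xy; rewrite e.
Qed.

Lemma parity_all L z : List.Forall (fun E => E z) L -> parity L z = odd (size L).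
Proof. by elim=> //= E L' Ez _ ->; rewrite asboolT. Qed.

Lemma parity_skip E L z : ~ E z -> parity (E :: L) z = parity L z.
Proof. by move=> nE; rewrite /parity /= asboolF. Qed.

(** * Recovering a chain of relations from its parities *)

Section Unique.
Variables (lt : set (T * T)) (cls : set (T * T) -> Prop).
Hypothesis cls_cmp : forall E F, cls E -> cls F -> E `<=` F \/ F `<=` E.
Hypothesis cls_pair : forall E F, cls E -> cls F -> ~ E `<=` F ->
  exists x y, [/\ lt (x, y), E (x, y) & ~ F (x, y)].
Local Notation chain L := (List.Forall cls L /\ StronglySorted (fun E F => E `<` F) L).
Local Notation agree K L L' :=
  (forall x y, lt (x, y) -> ~ K (x, y) -> parity L (x, y) = parity L' (x, y)).

Lemma chain_cons K L : chain (K :: L) ->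
  [/\ cls K, chain L & List.Forall (fun E => K `<` E) L].
Proof. by case=> /List.Forall_cons_iff [cK cL] hs; have [] := StronglySorted_inv hs. Qed.

Lemma chain_parity E L z : chain (E :: L) -> E z -> parity (E :: L) z = odd (size L).+1.
Proof.
move=> /chain_cons [_ _ h] Ez; apply: (@parity_all (E :: L)); constructor=> //.
by apply: List.Forall_impl h => F [+ _]; apply.
Qed.

Lemma chain_hd K E L : chain (K :: E :: L) -> [/\ cls K, cls E, ~ E `<=` K & chain (E :: L)].
Proof.
move=> /chain_cons [cK cEL /List.Forall_cons_iff [[_ nEK] _]]; split=> //.
by case: cEL => /List.Forall_cons_iff [].
Qed.

(** Pairs of [E] outside [K] lie in all of [E :: L], so this list has even length and [L] has a
    first member [F]. Pairs of [F] outside [E] then have odd parity. *)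
Lemma chain_agree_nil K E L : chain (K :: E :: L) -> agree K (E :: L) [::] -> False.
Proof.
move=> /chain_hd [cK cE nEK cEL] ag.
have [x [y [xy Exy nK]]] := cls_pair cE cK nEK.
have := ag x y xy nK; rewrite chain_parity //; case: L cEL ag => // F L cEL ag oL.
have [_ cF nFE cFL] := chain_hd cEL.
have [u [v [uv Fuv nE]]] := cls_pair cF cE nFE.
have nKuv : ~ K (u, v).
  move=> h; apply: nE; case: (cls_cmp cE cK) => // KE; exact: KE.
have := ag u v uv nKuv; rewrite parity_skip // chain_parity //.
by move: oL => /= /negbFE ->.
Qed.

(** On [E] outside [K] the two lists have lengths of the same parity. A pair that has just left [E]
    but not [E'] loses one member of the first list and none of the second, so its parities
    differ. *)
Lemma chain_agree_lt K E L E' L' : chain (K :: E :: L) -> chain (K :: E' :: L') ->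
  ~ E' `<=` E -> agree K (E :: L) (E' :: L') -> False.
Proof.
move=> /chain_hd [cK cE nEK cEL] /chain_hd [_ cE' nE'K cEL'] nE'E ag.
have EE' : E `<=` E' by case: (cls_cmp cE cE').
have KE : K `<=` E by case: (cls_cmp cE cK).
have [x [y [xy Exy nK]]] := cls_pair cE cK nEK.
have := ag x y xy nK; rewrite !chain_parity //; last exact: EE'.
case: L cEL ag => [|F L] cEL ag sz.
  have [u [v [uv E'uv nE]]] := cls_pair cE' cE nE'E.
  have := ag u v uv (fun h => nE (KE _ h)).
  by rewrite (chain_parity cEL') // -sz parity_skip.
have [_ cF nFE cFL] := chain_hd cEL.
suff [u [v [uv Fuv E'uv nE]]] : exists u v, [/\ lt (u, v), F (u, v), E' (u, v) & ~ E (u, v)].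
  have := ag u v uv (fun h => nE (KE _ h)); rewrite (chain_parity cEL') // -sz.
  by rewrite parity_skip // chain_parity //=; case: (odd _).
(* The pair is taken from the smaller of [F] and [E'], so that it lies in both. *)
case: (cls_cmp cF cE') => h.
  by have [u [v [? /[dup] /h ? ? ?]]] := cls_pair cF cE nFE; exists u, v.
by have [u [v [? /[dup] /h ? ? ?]]] := cls_pair cE' cE nE'E; exists u, v.
Qed.

(** The least members above [K] coincide; this common member replaces [K] in the induction, since
    the parities are only compared outside [K]. *)
Lemma chain_unique K L L' : chain (K :: L) -> chain (K :: L') -> agree K L L' -> L = L'.
Proof.
elim: L L' K => [|E L IH] [|E' L'] K cL cL' ag //.
- by case: (chain_agree_nil cL') => x y xy nK; rewrite ag.
- by case: (chain_agree_nil cL ag).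
have eE : E = E'.
  apply/seteqP; split; apply: contrapT => h.
    by apply: (chain_agree_lt cL' cL h) => x y xy nK; rewrite ag.
  exact: (chain_agree_lt cL cL' h ag).
rewrite -eE in cL' ag *; congr cons.
have [_ cE nEK cEL] := chain_hd cL; have [_ _ _ cEL'] := chain_hd cL'.
apply: (IH _ E) => // x y xy nE.
have [cK _ _ _] := chain_hd cL.
have nK : ~ K (x, y).
  by move=> h; apply: nE; case: (cls_cmp cE cK) => // KE; exact: KE.
by have := ag x y xy nK; rewrite !parity_skip.
Qed.

End Unique.
End Parity.

(** * Refining convex equivalence relations *)

Section Alternation.
Open Scope card_scope.
Variables (T : Type) (P : set T) (lt : set (T * T)).
Hypothesis hlt : linear_order P lt.

(** Going up from [x], the set [Y] is left and re-entered [n] times. *)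
Fixpoint alternates (Y : set T) n (x : T) : Prop :=
  [/\ P x, Y x & if n is n'.+1 then
     exists b a, [/\ P b, lt (x, b), ~ Y b, lt (b, a) & alternates Y n' a]
   else True].

Definition component (Y : set T) (a : T) : set T :=
  [set y | [/\ P y, Y y & forall u, P u ->
     (lt (a, u) /\ lt (u, y)) \/ (lt (y, u) /\ lt (u, a)) -> Y u]].

Lemma component_self Y a : P a -> Y a -> component Y a a.
Proof.
have [_ ltxx lttr _] := hlt => Pa Ya; split=> // u _.
by case=> -[h1 h2]; case: (ltxx a); apply: (lttr _ u).
Qed.

Lemma component_convex Y a : P a -> Y a -> convex_component P lt Y (component Y a).
Proof.
have [ltP ltxx lttr ltot] := hlt => Pa Ya; split.
- split=> [y []//|u z v [Pu Yu hu] [Pv Yv hv] Pz uz zv].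
  case: (ltot a z Pa Pz) => [az|<-|za]; last 2 first.
  + exact: component_self.
  + split=> [//||w Pw]; first by apply: hu => //; right.
    case=> -[h1 h2]; first by case: (ltxx a); apply: (lttr _ w) => //; apply: (lttr _ z).
    by apply: hu => //; right; split=> //; apply: (lttr _ z).
  split=> [//||w Pw]; first by apply: hv => //; left.
  case=> -[h1 h2]; last by case: (ltxx a); apply: (lttr _ z) => //; apply: (lttr _ w).
  by apply: hv => //; left; split=> //; apply: (lttr _ z).
- by move=> y [].
- move=> K [KP cK] KY sub; apply/seteqP; split=> // y Ky.
  have Ka : K a by apply/sub/component_self.
  split; [exact: KP | exact: KY | move=> u Pu].
  by case=> -[h1 h2]; apply: KY; [apply: (cK a u y) | apply: (cK y u a)].
Qed.

Lemma not_sub_lt (E F : set (T * T)) : equivalence_on P E -> equivalence_on P F ->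
  ~ E `<=` F -> exists x y, [/\ P x, P y, lt (x, y), E (x, y) & ~ F (x, y)].
Proof.
have [ltP ltxx lttr ltot] := hlt.
move=> [EP _ Es _] [_ Fr Fs _] nEF; apply: contrapT => h; apply: nEF => -[x y] xy.
apply: contrapT => nxy; have [/= Px Py] := EP _ xy.
case: (ltot x y Px Py) => [l|e|l]; apply: h.
- by exists x, y.
- by case: nxy; rewrite e; exact: Fr.
- by exists y, x; split=> //; [exact: Es | move/Fs].
Qed.

(** The bound is the number of components: [n] re-entries give [n.+1] points of [Y], any two
    separated by a point outside [Y], hence [n.+1] distinct components. *)
Lemma finite_alternates (Y : set T) : finite_set (convex_component P lt Y) ->
  exists n, forall x, ~ alternates Y n x.
Proof.
have [ltP ltxx lttr ltot] := hlt.
move=> /finite_setP [n]; rewrite card_eq_le => /andP[h _]; exists n => x hx.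
have {hx} [a ha hb] : exists2 a : nat -> T, (forall i, i <= n -> P (a i) /\ Y (a i)) &
    forall i j, i < j -> j <= n -> exists b, [/\ P b, lt (a i, b), lt (b, a j) & ~ Y b].
  suff [a [_ ? ?]] : exists a : nat -> T, [/\ a 0 = x,
    (forall i, i <= n -> P (a i) /\ Y (a i)) &
    forall i j, i < j -> j <= n -> exists b, [/\ P b, lt (a i, b), lt (b, a j) & ~ Y b]].
    by exists a.
  elim: n x hx {h} => [|n IH] x /= [Px Yx].
    by move=> _; exists (fun=> x); split=> // i [].
  move=> [b [y [Pb xb nYb yb /IH [a [a0 ha hb]]]]].
  exists (fun i => if i is i'.+1 then a i' else x); split=> // [[|i]//|]; first exact: ha.
  move=> [|i] [|j] // ij jn; last exact: hb.
  exists b; split=> //; case: j jn {ij} => [|j] jn; first by rewrite a0.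
  have [c [Pc h1 h2 _]] := hb 0 j.+1 isT jn.
  by apply: (lttr _ y) => //; rewrite -a0; apply: (lttr _ c).
suff : `I_n.+1 #<= convex_component P lt Y.
  by move=> /card_le_trans /(_ h); rewrite card_le_II ltnn.
suff [F] : $|{injfun `I_n.+1 >-> convex_component P lt Y}| by exact: inj_card_le F.
apply/injfunPex; exists (fun i => component Y (a i)).
  by move=> i /= lin; have [? ?] := ha i lin; exact: component_convex.
suff neq i j : i < j -> j <= n -> component Y (a i) <> component Y (a j).
  move=> i j; rewrite !inE /= => ni nj e.
  by case: (ltngtP i j) => // /neq; [move=> /(_ nj) | move=> /(_ ni) /(_ (esym e))].
move=> ij jn e; have [Pj Yj] := ha j jn.
have [b [Pb h1 h2 nYb]] := hb i j ij jn.
have := component_self Pj Yj; rewrite -e => -[_ _ /(_ b Pb)].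
by move=> /(_ (or_introl (conj h1 h2))).
Qed.

Lemma alternates_forever (Y : set T) : finite_set (convex_component P lt Y) ->
  (forall x, P x -> Y x ->
     exists b a, [/\ P b, lt (x, b), ~ Y b, lt (b, a) & Y a]) ->
  forall x, P x -> ~ Y x.
Proof.
have [ltP _ _ _] := hlt => /finite_alternates [n hn] h x Px Yx; apply: (hn x).
elim: n x Px Yx {hn} => [|n IH] x Px Yx //=; split=> //.
have [b [a [Pb xb nYb ba Ya]]] := h x Px Yx; exists b, a; split=> //.
by apply: IH => //; have [] := ltP _ ba.
Qed.

End Alternation.

(** * Invariant relations on a homogeneous linear order *)

Section Homogeneous.
Variables (T : Type) (P : set T) (lt : set (T * T)) (Aut : set (T -> T)).
Hypothesis hlt : linear_order P lt.
Hypothesis aut_trans : forall x x', P x -> P x' -> exists2 h, Aut h & h x = x'.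
Hypothesis aut_surj : forall h y, Aut h -> exists x, h x = y.
Hypothesis aut_P : forall h x, Aut h -> P (h x) = P x.
Definition invariant_rel (R : T -> T -> Prop) :=
  forall h x y, Aut h -> R (h x) (h y) = R x y.
Hypothesis aut_lt : invariant_rel (fun x y => lt (x, y)).

Definition finite_sections (R : T -> T -> Prop) :=
  forall x, P x -> finite_set (convex_component P lt (R x)).

(** A gap in one class is moved by homogeneity to every point, so that each point sees its class
    left and re-entered above it; the class would then have infinitely many components. *)
Lemma invariant_equivalence_convex (E : set (T * T)) : equivalence_on P E ->
  invariant_rel (fun x y => E (x, y)) -> finite_sections (fun x y => E (x, y)) ->
  convex_equivalence P lt E.
Proof.
have [ltP ltxx lttr ltot] := hlt.
move=> hE iE fE; split=> // x Px; have [EP Er Es Et] := hE.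
split=> [y /EP []//|a z b /= xa xb Pz az zb]; apply: contrapT => nz.
have next c : P c -> exists d e, [/\ P d, lt (c, d), ~ E (c, d), lt (d, e) & E (c, e)].
  move=> Pc; have Pa : P a by case/EP: xa.
  have [h hh <-] := aut_trans Pa Pc; exists (h z), (h b).
  rewrite (aut_P _ hh) !aut_lt // !iE //; split=> //; last first.
    by apply: Et xb; exact: Es.
  by move=> az'; apply: nz; apply: Et az'.
apply: (alternates_forever hlt (fE x Px) _ Px (Er x Px)) => c Pc xc.
have [d [e [Pd cd nE de Ee]]] := next c Pc; exists d, e; split=> //.
  by move=> xd; apply: nE; apply: Et xd; exact: Es.
exact: Et Ee.
Qed.

(** Take pairs witnessing both failures of inclusion and move them to a common left end [x]. The two
    right ends are comparable, and convexity puts the lower one in both classes of [x]. *)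
Lemma invariant_convex_comparable (E F : set (T * T)) :
  convex_equivalence P lt E -> convex_equivalence P lt F ->
  invariant_rel (fun x y => E (x, y)) -> invariant_rel (fun x y => F (x, y)) ->
  E `<=` F \/ F `<=` E.
Proof.
have [ltP ltxx lttr ltot] := hlt.
move=> [hE cE] [hF cF] iE iF; have [EP Er Es Et] := hE; have [FP Fr Fs Ft] := hF.
case: (pselect (E `<=` F)) => [|nEF]; first by left.
right; apply: contrapT => nFE.
have [x [y [Px Py xy Exy nFxy]]] := not_sub_lt hlt hE hF nEF.
have [u [v [Pu Pv uv Fuv nEuv]]] := not_sub_lt hlt hF hE nFE.
have [h hh hux] := aut_trans Pu Px.
move: uv Fuv nEuv Pv; rewrite -(aut_lt u v hh) -(iF h u v hh) -(iE h u v hh) -(aut_P v hh) hux.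
move: (h v) => w xw Fxw nExw Pw.
case: (ltot y w Py Pw) => [yw|e|wy].
- apply: nFxy; have [_ cx] := cF x Px.
  by apply: (cx x y w) => //; exact: Fr.
- by apply: nExw; rewrite -e.
- apply: nExw; have [_ cx] := cE x Px.
  by apply: (cx x w y) => //; exact: Er.
Qed.

(* Here [le x y] stands for f x <= f y, or for f y <= f x.  Inside each
   E-class, [reach x] is the initial segment spanned by {w | le w x}; the
   classes of [refine le E] are the sets on which [reach] is constant. *)
Section Step.
Variables (le : T -> T -> Prop) (E : set (T * T)).
Hypothesis le_refl : forall x, P x -> le x x.
Hypothesis le_trans : forall x y z, P x -> P y -> P z -> le x y -> le y z -> le x z.
Hypothesis aut_le : invariant_rel le.
Hypothesis fin_le : finite_sections le.
Hypothesis hE : convex_equivalence P lt E.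
Hypothesis aut_E : invariant_rel (fun x y => E (x, y)).

Definition reach x y :=
  exists w, [/\ P w, y = w \/ lt (y, w), E (x, w) & le w x].

Definition refine : set (T * T) :=
  [set z | [/\ P z.1, P z.2, reach z.1 z.2 & reach z.2 z.1]].

Lemma reach_invariant : invariant_rel reach.
Proof.
move=> h x y hh; apply/propext; split=> -[w [Pw yw Ew lew]].
  have [v ev] := aut_surj w hh; move: Pw yw Ew lew; rewrite -ev.
  rewrite aut_P // aut_lt // aut_E // aut_le // => Pv yv Ev lev; exists v; split=> //.
  case: yv => [|]; last by right.
  (* Injectivity of [h] on [P] comes from its preserving a strict linear order. *)
  have [ltP ltxx lttr ltot] := hlt => e; left.
  have Py : P y by rewrite -(aut_P y hh) e aut_P.
  case: (ltot y v Py Pv) => // l; case: (ltxx (h v)); [rewrite -{1}e|rewrite -{2}e];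
    by rewrite aut_lt.
exists (h w); rewrite aut_P // aut_lt // aut_E // aut_le //; split=> //.
by case: yw => [->|]; [left | right].
Qed.

Lemma refine_invariant : invariant_rel (fun x y => refine (x, y)).
Proof.
by move=> h x y hh; rewrite /refine /= !aut_P // !reach_invariant.
Qed.

(** The hypotheses describe a drop of [reach] from [x] to [b]. Homogeneity produces such a drop at
    every point, and iterating makes some set [le z] alternate as often as desired, against the
    uniform bound on its components. *)
Lemma no_drop x b a : P x -> P b -> P a -> lt (x, b) -> lt (b, a) -> E (x, a) ->
  le a x -> (forall w, P w -> a = w \/ lt (a, w) -> E (x, w) -> ~ le w b) -> False.
Proof.
have [ltP ltxx lttr ltot] := hlt; have [[EP Er Es Et] _] := hE.
move=> Px Pb Pa xb ba xa lax hw.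
have next y : P y -> exists b a, [/\ P b, P a, lt (y, b), lt (b, a) & [/\ E (y, a), le a y &
    forall w, P w -> a = w \/ lt (a, w) -> E (y, w) -> ~ le w b]].
  move=> Py; have [h hh <-] := aut_trans Px Py; exists (h b), (h a).
  rewrite !aut_P // !aut_lt // aut_E // aut_le //; split=> //; split=> //.
  move=> w; have [v <-] := aut_surj w hh; rewrite aut_P // aut_lt // aut_E // aut_le //.
  move=> Pv av; apply: hw => //; case: av => [e|]; last by right.
  left; case: (ltot a v Pa Pv) => // l; case: (ltxx (h v)); [rewrite -{1}e|rewrite -{2}e];
    by rewrite aut_lt.
(* [z] is the last point of the iteration. It is [le] all the points where a drop starts, but not
   [le] the intermediate points [c], since it lies at or above the corresponding [d] in the same
   class. *)
have chain n y : P y -> exists z, [/\ P z, y = z \/ lt (y, z), E (y, z), le z y &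
    alternates P lt (le z) n y].
  elim: n y => [|n IH] y Py.
    by exists y; split=> //; [left | exact: Er | exact: le_refl | split=> //; exact: le_refl].
  have [c [d [Pc Pd yc cd [Eyd ldy hd]]]] := next y Py.
  have [z [Pz dz Edz lzd hz]] := IH d Pd.
  have lzy : le z y by apply: le_trans ldy.
  have Eyz : E (y, z) by apply: Et Edz.
  have yd : lt (y, d) by apply: lttr cd.
  exists z; split=> //; first by right; case: dz => [<-|] //; exact: lttr.
  split=> //; exists c, d; split=> //; exact: hd.
have [n hn] := finite_alternates hlt (fin_le Px).
have [z [Pz _ _ _ hz]] := chain n x Px.
(* [z] depends on the number of iterations; moving it to [x] allows the bound [n], fixed beforehand
   for [x], to apply. *)
have [h hh hzx] := aut_trans Pz Px.
suff im m y : alternates P lt (le z) m y -> alternates P lt (le (h z)) m (h y).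
  by have := im _ _ hz; rewrite hzx; exact: hn.
elim: m y => [|m IH] y /= [Py ly]; first by rewrite aut_P // aut_le.
move=> [c [d [Pc yc nc cd /IH hd]]].
rewrite aut_P // aut_le //; split=> //; exists (h c), (h d).
by rewrite aut_P // !aut_lt // aut_le.
Qed.

Lemma reach_le x y z : P x -> P y -> E (x, y) -> le x y -> reach x z -> reach y z.
Proof.
have [[EP Er Es Et] _] := hE.
move=> Px Py xy lxy [w [Pw zw xw lwx]]; exists w; split=> //.
  by apply: Et xw; exact: Es.
exact: le_trans lxy.
Qed.

(** Let [w] witness [reach x z]. If [w] lies above [y], losing [z] would be a drop as excluded by
    [no_drop]; otherwise [z] is at most [y], and [y] is its own witness. *)
Lemma reach_lt x y z : P x -> P y -> P z -> E (x, y) -> lt (x, y) -> reach x z -> reach y z.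
Proof.
have [ltP ltxx lttr ltot] := hlt; have [[EP Er Es Et] _] := hE.
move=> Px Py Pz xy lxy [w [Pw zw xw lwx]].
have yw : E (y, w) by apply: Et xw; exact: Es.
case: (ltot y w Py Pw) => [ltyw|e|ltwy].
- apply: contrapT => nr; apply: (no_drop Px Py Pw lxy ltyw xw lwx) => v Pv wv xv lvy.
  apply: nr; exists v; split=> //; last by apply: Et xv; exact: Es.
  by case: wv zw => [<-|wv] [->|zw]; [left | right | right | right; exact: lttr wv].
- by exists y; split=> //; [rewrite e | exact: Er | exact: le_refl].
- exists y; split=> //; [|exact: Er | exact: le_refl].
  by right; case: zw => [->//|zw]; exact: lttr ltwy.
Qed.

Lemma reach_down x y z : P y -> lt (z, y) -> reach x y -> reach x z.
Proof.
have [ltP ltxx lttr ltot] := hlt.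
move=> Py zy [w [Pw yw xw lwx]]; exists w; split=> //; right.
by case: yw => [<-|] //; exact: lttr.
Qed.

Lemma reach_self x : P x -> reach x x.
Proof.
have [[EP Er Es Et] _] := hE.
by move=> Px; exists x; split=> //; [left | exact: Er | exact: le_refl].
Qed.

Lemma reach_class x y : P x -> P y -> x = y \/ lt (x, y) -> reach x y -> E (x, y).
Proof.
have [ltP ltxx lttr ltot] := hlt; have [[EP Er Es Et] cE] := hE.
move=> Px Py [<- _|xy]; first exact: Er.
move=> [w [Pw [->//|yw] xw lwx]]; have [_ cx] := cE x Px.
by apply: (cx x y w) => //; exact: Er.
Qed.

Lemma refine_sub : refine `<=` E.
Proof.
have [ltP ltxx lttr ltot] := hlt; have [[EP Er Es Et] cE] := hE.
move=> [x y] [/= Px Py rxy ryx]; case: (ltot x y Px Py) => [l|e|l].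
- by apply: reach_class => //; right.
- by apply: reach_class => //; left.
- by apply: Es; apply: reach_class => //; right.
Qed.

Lemma refine_lt x y : P x -> P y -> lt (x, y) -> reach x y -> refine (x, y).
Proof. by move=> Px Py xy rxy; split=> //=; exact: reach_down (reach_self Py). Qed.

(** If [x] is below [y], [reach] grows along the order. If [x] is above [y], a witness [w] of
    [reach y x] satisfies [le w y], and [reach] grows from [x] to [w] and from [w] to [y]. *)
Lemma reach_refine x y z : refine (x, y) -> P z -> reach x z -> reach y z.
Proof.
have [ltP ltxx lttr ltot] := hlt; have [[EP Er Es Et] cE] := hE.
move=> xy; have Exy := refine_sub xy; case: xy => /= Px Py rxy ryx Pz rxz.
case: (ltot x y Px Py) => [l|<-//|l]; first exact: reach_lt rxz.
have [w [Pw xw yw lwy]] := ryx.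
apply: (reach_le Pw Py (Es _ _ yw) lwy).
case: xw rxz => [<-//|xw]; apply: reach_lt => //.
by apply: Et yw.
Qed.

Lemma refineP x y : refine (x, y) <->
  E (x, y) /\ (forall z, P z -> reach x z <-> reach y z).
Proof.
have [[EP Er Es Et] cE] := hE; split=> [xy|[/EP /= [Px Py] h]].
  split=> [|z Pz]; first exact: refine_sub.
  split; first exact: reach_refine.
  by apply: reach_refine => //; case: xy.
by split=> //=; [apply/h | apply/h]; rewrite //; exact: reach_self.
Qed.

Lemma refine_convex : convex_equivalence P lt refine.
Proof.
have [ltP ltxx lttr ltot] := hlt; have [[EP Er Es Et] cE] := hE.
have eq' : equivalence_on P refine.
  split.
  - by move=> [x y] [].
  - by move=> x Px; split=> //=; exact: reach_self.
  - by move=> x y [].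
  - move=> x y z /refineP [xy h1] /refineP [yz h2]; apply/refineP.
    by split=> [|w Pw]; [exact: Et yz | rewrite h1 // h2].
have [_ Fr Fs Ft] := eq'.
split=> // x Px; split=> [y []//|a z b /= xa xb Pz az zb].
have ab : refine (a, b) by apply: Ft xb; exact: Fs.
have [/= Pa Pb rab _] := ab; apply: (Ft _ a) => //; apply: refine_lt => //.
exact: reach_down rab.
Qed.

Lemma refine_ker x y : E (x, y) -> le x y -> le y x -> refine (x, y).
Proof.
have [[EP Er Es Et] cE] := hE.
move=> xy lxy lyx; have [/= Px Py] := EP _ xy; apply/refineP; split=> // z Pz.
by split; apply: reach_le => //; exact: Es.
Qed.

(** Otherwise [y] itself would witness [reach x y]. Thus all pairs separated by one refinement carry
    the same sign. *)
Lemma refine_sign x y : E (x, y) -> ~ refine (x, y) -> lt (x, y) -> ~ le y x.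
Proof.
have [[EP Er Es Et] cE] := hE.
move=> xy nxy ltxy lyx; have [/= Px Py] := EP _ xy; apply: nxy; apply: refine_lt => //.
by exists y; split=> //; left.
Qed.

(** Along [le] the sets [reach] grow from [u] to [z] to [v], and those of [u] and [v] agree, so the
    one of [z] is squeezed between equal sets. *)
Lemma refine_le_convex :
  (forall u z v, P u -> P z -> P v -> le u z -> le z v -> E (u, v) -> E (u, z)) ->
  forall u z v, P u -> P z -> P v -> le u z -> le z v -> refine (u, v) -> refine (u, z).
Proof.
have [[EP Er Es Et] cE] := hE.
move=> fc u z v Pu Pz Pv uz zv /refineP [uv h].
have Euz : E (u, z) by exact: fc uv.
apply/refineP; split=> // w Pw; split; first exact: reach_le.
rewrite h //; apply: reach_le => //; apply: Et uv; exact: Es.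
Qed.

Lemma refine_strict : refine <> E ->
  exists x y, [/\ P x, P y, lt (x, y), E (x, y) & ~ refine (x, y)].
Proof.
move=> ne; have [eE _] := hE; have [eF _] := refine_convex.
by apply: not_sub_lt => // h; apply: ne; apply/seteqP; split=> //; exact: refine_sub.
Qed.

End Step.

(** A witness [w] of [reach x y] also witnesses [reach x w], so it belongs to the refined class of
    [x] and still serves there. Hence only the opposite sign can refine further. *)
Lemma refine_idem le E : (forall x, P x -> le x x) ->
  (forall x y z, P x -> P y -> P z -> le x y -> le y z -> le x z) ->
  invariant_rel le -> finite_sections le ->
  convex_equivalence P lt E -> invariant_rel (fun x y => E (x, y)) ->
  refine le (refine le E) = refine le E.
Proof.
move=> lr lt' il fl hE iE; have hF := refine_convex lr lt' il fl hE iE.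
apply: contrapT => ne.
have iF := refine_invariant il iE.
have [x [y [Px Py xy Fxy nF]]] := refine_strict lr lt' il fl hF iF ne.
apply: nF; apply: (refine_lt lr hF) => //.
have [/= _ _ [w [Pw yw xw lwx]] _] := Fxy; exists w; split=> //.
have [ltP ltxx lttr ltot] := hlt.
apply: (refine_lt lr hE) => //; first by case: yw => [<-//|]; exact: lttr.
by exists w; split=> //; left.
Qed.

(** * Alternating refinements down to the kernel *)

Section Layers.
Variable le : T -> T -> Prop.
Hypothesis le_refl : forall x, P x -> le x x.
Hypothesis le_trans : forall x y z, P x -> P y -> P z -> le x y -> le y z -> le x z.
Hypothesis le_total : forall x y, P x -> P y -> le x y \/ le y x.
Hypothesis aut_le : invariant_rel le.
Hypothesis fin_le : finite_sections le.
Hypothesis fin_ge : finite_sections (fun x y => le y x).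
Variable Def : set (T * T) -> Prop.

Definition signed (b : bool) : T -> T -> Prop := if b then le else fun x y => le y x.

(** [Def] stands for relative definability, kept abstract here. Convexity with respect to [le] is
    carried along because it makes the images of the classes have disjoint hulls in the range. *)
Definition layer (E : set (T * T)) : Prop :=
  [/\ convex_equivalence P lt E, invariant_rel (fun x y => E (x, y)),
      forall x y, P x -> P y -> le x y -> le y x -> E (x, y),
      forall u z v, P u -> P z -> P v -> le u z -> le z v -> E (u, v) -> E (u, z)
    & Def E].

Hypothesis DefT : Def (P `*` P).
Hypothesis Def_refine : forall b E, layer E -> Def (refine (signed b) E).

Lemma signed_refl b x : P x -> signed b x x.
Proof. by case: b; exact: le_refl. Qed.

Lemma signed_trans b x y z : P x -> P y -> P z ->
  signed b x y -> signed b y z -> signed b x z.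
Proof.
by case: b => /= Px Py Pz xy yz; [exact: le_trans yz | exact: le_trans xy].
Qed.

Lemma signed_invariant b : invariant_rel (signed b).
Proof. by case: b => // h x y hh; exact: aut_le. Qed.

Lemma signed_finite b : finite_sections (signed b).
Proof. by case: b. Qed.

Lemma le_convex_op (R : T -> T -> Prop) E : equivalence_on P E ->
  (forall u z v, P u -> P z -> P v -> R u z -> R z v -> E (u, v) -> E (u, z)) ->
  forall u z v, P u -> P z -> P v -> R z u -> R v z -> E (u, v) -> E (u, z).
Proof.
move=> [_ _ Es Et] h u z v Pu Pz Pv zu vz uv; apply: (Et _ _ _ uv).
by apply: (h v z u) => //; exact: Es.
Qed.

Lemma layerT : layer (P `*` P).
Proof.
have eT : equivalence_on P (P `*` P).
  by split=> //= [x y [] | x y z [? ?] []].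
split=> //; last by move=> h x y hh /=; rewrite !aut_P.
by split=> // x Px; split=> [y []|a z b /= ? ? ? _ _].
Qed.

Lemma layer_refine b E : layer E -> layer (refine (signed b) E).
Proof.
move=> lE; have [hE iE kE cE _] := lE.
have sr := @signed_refl; have st := @signed_trans.
have si := @signed_invariant; have sf := @signed_finite.
have hF := refine_convex (sr b) (st b) (si b) (sf b) hE iE.
split=> //; last exact: Def_refine.
- exact: refine_invariant (@signed_invariant b) iE.
- move=> x y Px Py xy yx.
  by apply: (refine_ker (sr b) (st b) (si b) (sf b) hE iE); [exact: kE | case: (b) | case: (b)].
case: b hF => hF; first exact: (refine_le_convex (sr true) (st true) (si true) (sf true) hE iE).
apply: (@le_convex_op (signed false)); first by case: hF.
apply: (refine_le_convex (sr false) (st false) (si false) (sf false) hE iE).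
by apply: le_convex_op => //; case: hE.
Qed.

(** If neither sign refines [E], then beyond every point of a class there are later points [b] with
    [le b x] and [a] with [le y a]. When [le y x] fails, these alternate outside and inside [le y]
    without end. *)
Lemma refine_progress E : layer E -> (forall b, refine (signed b) E = E) ->
  forall x y, E (x, y) -> le x y.
Proof.
have [ltP ltxx lttr ltot] := hlt.
move=> [hE iE _ _ _] fixE; have [[EP Er Es Et] _] := hE.
have sr := @signed_refl; have st := @signed_trans.
have step b x c : E (x, c) -> reach (signed b) E x c.
  by move=> xc; move: (xc); rewrite -{1}(fixE b) => -[].
move=> y x yx; apply: contrapT => nyx.
have [Py Px] : P y /\ P x by case: (EP _ yx).
have lxy : le x y by case: (le_total Py Px).
have [n hn] := finite_alternates hlt (fin_le Py).
suff chain m c : P c -> le y c -> E (y, c) -> alternates P lt (le y) m c.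
  by apply: (hn y); apply: chain => //; [exact: le_refl | exact: Er].
elim: m c => [|m IH] c Pc yc Eyc /=; first by split.
have Exc : E (x, c) by apply: Et Eyc; exact: Es.
have [b [Pb cb Exb /= lbx]] := step true x c Exc.
have nyb : ~ le y b by move=> yb; apply: nyx; apply: le_trans lbx.
have ltcb : lt (c, b) by case: cb nyb => [<-|].
have Eyb : E (y, b) by apply: Et Exb.
have [a [Pa ba Eya /= lya]] := step false y b Eyb.
split=> //; exists b, a; split=> //; last exact: IH.
by case: ba nyb => [->|].
Qed.

Fixpoint layer_seq b0 n : set (T * T) :=
  if n is n'.+1 then refine (signed (b0 (+) odd n')) (layer_seq b0 n') else P `*` P.

Lemma layer_seq_layer b0 n : layer (layer_seq b0 n).
Proof. by elim: n => [|n IH]; [exact: layerT | exact: layer_refine]. Qed.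

Lemma layer_seq_sub b0 n : layer_seq b0 n.+1 `<=` layer_seq b0 n.
Proof.
have [hE iE _ _ _] := layer_seq_layer b0 n.
exact: refine_sub hE.
Qed.

Lemma layer_seq_sign b0 n x y : layer_seq b0 n (x, y) -> ~ layer_seq b0 n.+1 (x, y) ->
  lt (x, y) -> ~ signed (b0 (+) odd n) y x.
Proof.
have [hE iE _ _ _] := layer_seq_layer b0 n.
exact: (refine_sign (@signed_refl _) hE).
Qed.

Definition level : set (T * T) := [set z | [/\ P z.1, P z.2, le z.1 z.2 & le z.2 z.1]].

Lemma layer_level E : layer E -> (forall x y, E (x, y) -> le x y) -> E = level.
Proof.
move=> [[[EP Er Es Et] _] _ kE _ _] h; apply/seteqP; split=> -[x y].
  by move=> xy; have [/= Px Py] := EP _ xy; split=> //=; apply: h => //; exact: Es.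
by move=> [/= Px Py xy yx]; exact: kE.
Qed.

(** The sign used last has no further effect by [refine_idem]. If the other one had none either,
    [refine_progress] would put the layer at [level]. *)
Lemma layer_seq_strict b0 : refine (signed b0) (P `*` P) <> P `*` P ->
  forall n, layer_seq b0 n <> level -> layer_seq b0 n.+1 <> layer_seq b0 n.
Proof.
move=> h0 [|n] nk; first by rewrite /= addbF.
move=> e; apply: nk; apply: layer_level; first exact: layer_seq_layer.
apply: refine_progress; first exact: layer_seq_layer.
have [hE iE _ _ _] := layer_seq_layer b0 n.
have id : refine (signed (b0 (+) odd n)) (layer_seq b0 n.+1) = layer_seq b0 n.+1.
  exact: refine_idem (@signed_refl _) (@signed_trans _) (@signed_invariant _)
    (@signed_finite _) hE iE.
move=> b; case: (eqVneq b (b0 (+) odd n)) => [->//|ne].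
have -> : b = b0 (+) odd n.+1 by move: ne; rewrite /=; case: b (b0) (odd n) => -[] [].
exact: e.
Qed.

(** Otherwise choose above one point [x0] a [y n] in layer [n] but not in layer [n.+1]. Convexity
    makes [y] strictly decreasing, while the truth of [le x0 (y n)] alternates with [n]. *)
Lemma layer_seq_level b0 : P !=set0 ->
  refine (signed b0) (P `*` P) <> P `*` P -> exists n, layer_seq b0 n = level.
Proof.
have [ltP ltxx lttr ltot] := hlt.
move=> [x0 Px0] h0; apply: contrapT => nlev.
have /choice [y hy] n : exists y, [/\ P y, lt (x0, y), layer_seq b0 n (x0, y) &
    ~ layer_seq b0 n.+1 (x0, y)].
  have [hE iE _ _ _] := layer_seq_layer b0 n.
  have [_ iF _ _ _] := layer_seq_layer b0 n.+1.
  have ne : layer_seq b0 n.+1 <> layer_seq b0 n.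
    by apply: layer_seq_strict => // e; apply: nlev; exists n.
  have [x [y [Px Py xy Exy nF]]] := refine_strict (@signed_refl _) (@signed_trans _)
    (@signed_invariant _) (@signed_finite _) hE iE ne.
  (* Translation gives all the separated pairs the same left end [x0]. *)
  have [h hh hx] := aut_trans Px Px0; exists (h y).
  by rewrite -{1 2 3}hx aut_P // aut_lt // iE // iF.
have ylt n : lt (y n.+1, y n).
  have [Pn1 xn1 En1 _] := hy n.+1; have [Pn xn En nEn] := hy n.
  have [[eF cF] _ _ _ _] := layer_seq_layer b0 n.+1.
  case: (ltot (y n.+1) (y n) Pn1 Pn) => // [e|l]; first by case: nEn; rewrite -e.
  case: nEn; have [_ Fr _ _] := eF; have [_ cx] := cF x0 Px0.
  by apply: (cx x0 _ (y n.+1)) => //; exact: Fr.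
have ysign n : if b0 (+) odd n then le x0 (y n) else ~ le x0 (y n).
  have [Pn xn En nEn] := hy n; have := layer_seq_sign En nEn xn.
  by case: ifP => // _ nle; case: (le_total Px0 Pn).
have [n hn] := finite_alternates hlt (fin_le Px0).
(* [o] is the first index where [le x0] holds. As [y] decreases, the alternation is read upwards
   starting from the large index [o + n.*2]. *)
pose o := nat_of_bool (~~ b0).
have oE : b0 (+) odd o by rewrite /o; case: (b0).
apply: (hn (y (o + n.*2))); elim: (n) => [|m IH].
  have [Pn _ _ _] := hy o; rewrite addn0 /=; split=> //.
  by have := ysign o; rewrite oE.
have [Pm _ _ _] := hy (o + m.+1.*2).
split=> //; first by have := ysign (o + m.+1.*2); rewrite oddD odd_double addbF oE.
exists (y (o + m.*2).+1), (y (o + m.*2)); split=> //.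
- by have [] := hy (o + m.*2).+1.
- by rewrite doubleS !addnS; exact: ylt.
- by have := ysign (o + m.*2).+1; rewrite /= oddD odd_double addbF addbN oE.
Qed.

(** The smallest relation comes first. The coarsest one, [P * P], is included exactly when the first
    separated pairs are order-reversing, that is, when [b0] is false. *)
Fixpoint layer_list b0 n : seq (set (T * T)) :=
  if n is n'.+1 then layer_seq b0 n :: layer_list b0 n'
  else if b0 then [::] else [:: P `*` P].

Lemma layer_list_Forall b0 n :
  List.Forall (fun E => layer E /\ layer_seq b0 n `<=` E) (layer_list b0 n).
Proof.
elim: n => [|n IH] /=.
  by case: b0; constructor=> //; split=> //; exact: layerT.
constructor; first by split=> //; exact: layer_seq_layer b0 n.+1.
apply: List.Forall_impl IH => E [lE sE]; split=> //.
exact: subset_trans (@layer_seq_sub b0 n) sE.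
Qed.

Lemma layer_list_sorted b0 n : (forall m, m < n -> layer_seq b0 m.+1 <> layer_seq b0 m) ->
  StronglySorted (fun E F => E `<` F) (layer_list b0 n).
Proof.
elim: n => [|n IH] ne /=; first by case: b0 {ne}; repeat constructor.
constructor; first by apply: IH => m mn; apply: ne; exact: ltnW.
apply: List.Forall_impl (layer_list_Forall b0 n) => E [_ sE].
split; first exact: subset_trans (@layer_seq_sub b0 n) sE.
move=> Es; apply: (ne n) => //; apply/seteqP; split; first exact: layer_seq_sub.
exact: subset_trans sE Es.
Qed.

(** A pair in layer [n] lies in the whole list, whose length has the stated parity. A pair outside
    got its sign from the stage that separated it, and the smaller layers added afterwards do not
    contain it. *)
Lemma layer_list_parity b0 n x y : P x -> P y -> lt (x, y) ->
  let odd_flips := parity (layer_list b0 n) (x, y) in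
  (layer_seq b0 n (x, y) -> odd_flips = ~~ (b0 (+) odd n)) /\
  (~ layer_seq b0 n (x, y) -> if odd_flips then le y x else le x y).
Proof.
move=> Px Py xy /=; elim: n => [|n [IH1 IH2]].
  split=> [_|h]; last by case: h.
  by case: b0 => //=; rewrite asboolT.
have -> : parity (layer_list b0 n.+1) (x, y) =
  `[< layer_seq b0 n.+1 (x, y) >] (+) parity (layer_list b0 n) (x, y) by [].
split=> [En|nEn].
  by rewrite asboolT // IH1 /=; [case: (b0) (odd n) => -[] | exact: layer_seq_sub En].
rewrite asboolF // addFb; case: (pselect (layer_seq b0 n (x, y))) => [En|//].
rewrite IH1 //; have := layer_seq_sign En nEn xy.
by case: (b0 (+) odd n) => /= nle; case: (le_total Px Py).
Qed.

Lemma layers_exist : (exists x y, [/\ P x, P y & ~ le x y]) ->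
  exists Es, [/\ List.Forall layer Es, StronglySorted (fun E F => E `<` F) Es,
    ohead Es = Some level &
    forall x y, P x -> P y -> lt (x, y) ->
      if parity Es (x, y) then le y x else le x y].
Proof.
move=> [u [v [Pu Pv nuv]]].
have nT : P `*` P <> level.
  by move=> e; apply: nuv; have [] : level (u, v) by rewrite -e.
(* If both signs left [P * P] unchanged, [P * P] would already be [level]. The sign found here
   starts the alternation. *)
have [b0 h0] : exists b0, refine (signed b0) (P `*` P) <> P `*` P.
  apply: contrapT => h; apply: nT; apply: (layer_level layerT).
  by apply: (refine_progress layerT) => b; apply: contrapT => hb; apply: h; exists b.
have [m0 hm0] := layer_seq_level (ex_intro _ u Pu) h0.
have hex : exists m, `[< layer_seq b0 m = level >] by exists m0; apply/asboolP.
case: (ex_minnP hex) => m /asboolP Em min.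
have strict k : k < m -> layer_seq b0 k.+1 <> layer_seq b0 k.
  move=> km; apply: layer_seq_strict => // e.
  by have := min k; rewrite leqNgt km => /(_ (asboolT e)).
exists (layer_list b0 m); split.
- by apply: List.Forall_impl (layer_list_Forall b0 m) => E [].
- exact: layer_list_sorted.
(* [m] is positive because [P * P] is not [level], so the list starts with layer [m]; minimality of
   [m] gave strictness. *)
- by case: m Em {min strict} => [/nT //|m Em]; rewrite -Em.
- move=> x y Px Py xy; have [_] := layer_list_parity b0 m Px Py xy; rewrite Em => h.
  by case: (pselect (level (x, y))) => // -[/= _ _ ? ?]; case: ifP.
Qed.

End Layers.
End Homogeneous.

(** * Relations on the range *)

Section Hull.
Variables (T U : Type) (D : set U) (ltD : set (U * U)).
Hypothesis hD : linear_order D ltD.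
Variables (X : set T) (E : T -> T -> Prop) (g : T -> U).
Local Notation leD d e := (ltD (d, e) \/ d = e).
Hypothesis gD : forall u, X u -> D (g u).
Hypothesis Er : forall u, X u -> E u u.
Hypothesis Es : forall u v, X u -> X v -> E u v -> E v u.
Hypothesis Et : forall u v w, X u -> X v -> X w -> E u v -> E v w -> E u w.
Hypothesis E_convex : forall u z v, X u -> X z -> X v ->
  leD (g u) (g z) -> leD (g z) (g v) -> E u v -> E u z.

(* The E-classes have convex images in g(X), so their convex hulls in D are
   pairwise disjoint. *)
Definition hull : set (U * U) :=
  [set z | [/\ D z.1, D z.2 & z.1 = z.2 \/ exists u v,
    [/\ X u, X v, E u v, leD (g u) z.1 /\ leD (g u) z.2 & leD z.1 (g v) /\ leD z.2 (g v)]]].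

Lemma leD_trans d e e' : leD d e -> leD e e' -> leD d e'.
Proof.
have [_ _ lttr _] := hD; case=> [de|->] // [ee'|<-]; last by left.
by left; exact: lttr ee'.
Qed.

Lemma leD_total d e : D d -> D e -> leD d e \/ leD e d.
Proof.
have [_ _ _ ltot] := hD => Dd De.
by case: (ltot d e Dd De) => [?|->|?]; [left; left | left; right | right; left].
Qed.

Lemma hull_image x y : X x -> X y -> (g x = g y -> E x y) ->
  hull (g x, g y) <-> E x y.
Proof.
move=> Xx Xy ker; split=> [[_ _ [/ker//|[u [v [Xu Xv uv [/= ux uy] [xv yv]]]]]]|xy].
  apply: (Et Xx Xu Xy); last exact: E_convex uv.
  by apply: Es => //; exact: E_convex uv.
split; rewrite /=; [exact: gD | exact: gD | right].
case: (leD_total (gD Xx) (gD Xy)) => l.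
  by exists x, y; split=> //; split=> //; right.
by exists y, x; split=> //; [exact: Es | split=> //; right | split=> //; right].
Qed.

Lemma hull_equivalence : equivalence_on D hull.
Proof.
split.
- by move=> z [].
- by move=> x Dx; split=> //; left.
- move=> x y [/= Dx Dy xy]; split=> //=; case: xy => [->|]; first by left.
  by move=> [u [v [Xu Xv uv [? ?] [? ?]]]]; right; exists u, v.
move=> x y z [/= Dx Dy xy] [/= _ Dz yz]; split=> //=.
case: xy yz => [->|[u [v [Xu Xv uv [ux uy] [xv yv]]]]] //.
case=> [<-|[u' [v' [Xu' Xv' uv' [uy' uz'] [yv' zv']]]]].
  by right; exists u, v.
right.
(* Both intervals contain [y], so the larger of [g u] and [g u'] falls inside the other interval,
   and convexity identifies the two classes. The joint interval then takes the outermost ends. *)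
have uu' : E u u'.
  case: (leD_total (gD Xu) (gD Xu')) => l.
    by apply: (E_convex (v := v)) => //; exact: leD_trans yv.
  apply: Es => //; apply: (E_convex (v := v')) => //; exact: leD_trans yv'.
have vu : E v u by exact: Es.
have vv' : E v v' by apply: (Et Xv Xu' Xv') => //; exact: (Et Xv Xu Xu').
have uv2 : E u v' by exact: (Et Xu Xu' Xv').
have u'v : E u' v by apply: (Et Xu' Xv' Xv) => //; exact: Es.
case: (leD_total (gD Xu) (gD Xu')) => lu; case: (leD_total (gD Xv) (gD Xv')) => lv.
- by exists u, v'; split=> //; split=> //; apply: leD_trans; eassumption.
- by exists u, v; split=> //; split=> //; apply: leD_trans; eassumption.
- by exists u', v'; split=> //; split=> //; apply: leD_trans; eassumption.
- by exists u', v; split=> //; split=> //; apply: leD_trans; eassumption.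
Qed.

Lemma hull_convex : convex_equivalence D ltD hull.
Proof.
have [_ ltxx lttr _] := hD.
split; first exact: hull_equivalence.
have [_ _ hs ht] := hull_equivalence.
move=> x Dx; split=> [y []//|a z b /= xa xb Dz az zb].
have [/= Da Db ab] : hull (a, b) by apply: ht xb; exact: hs.
apply: (ht _ _ _ xa); split=> //=; right.
case: ab => [e|[u [v [Xu Xv uv [ua ub] [av bv]]]]].
  by case: (ltxx a); apply: (lttr _ z) => //; rewrite e.
exists u, v; split=> //; split=> //; first by apply: leD_trans ua _; left.
by apply: leD_trans bv; left.
Qed.

End Hull.

(** * Weakly o-minimal pairs *)

Ltac renaming_tac :=
  lazymatch goal with
  | |- renaming (fun d => d) => exact: renaming_id
  | |- renaming (fun d => tleft d) => exact: renaming_left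
  | |- renaming (fun d => tright d) => exact: renaming_right
  | |- renaming (fun d => tleft (@?n d)) =>
      refine (renaming_comp (n := n) (@renaming_left _ _ _ _) _); renaming_tac
  | |- renaming (fun d => tright (@?n d)) =>
      refine (renaming_comp (n := n) (@renaming_right _ _ _ _) _); renaming_tac
  | |- renaming _ => first [exact: renaming_left | exact: renaming_right | exact: renaming_id]
  end.

Section TypeOrder.
Variables (L : signature) (K : Type) (C : structure L).
Hypothesis hK : infinite_set [set: K].
Hypothesis hsat : saturated K C.
Hypothesis hhom : strongly_homogeneous K C.
Variables (A : set (elt C)) (G : seq (Sorts L)) (p : set (pformula C G)).
Variable lt : set (tup C G * tup C G).
Hypothesis hA : small K A.
Hypothesis hwom : weakly_ominimal_pair A p lt.
Local Notation P := (realizations p).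
Local Notation tp := (tup C).

Definition type_aut_group : set (tp G -> tp G) :=
  [set h | exists2 g : (forall s, C s -> C s), automorphism g &
     (forall s (x : C s), A (existT _ s x) -> g s x = x) /\ h = (fun a : tp G => map_tup g a)].
Local Notation Aut := type_aut_group.

Lemma type_aut_trans x x' : P x -> P x' -> exists2 h, Aut h & h x = x'.
Proof.
have [hp _ _ _] := hwom => Px Px'.
have [g [hg fg gx]] := type_homogeneous hK hhom hA hp Px Px'.
by exists (fun a => map_tup g a) => //; exists g.
Qed.

Lemma type_aut_surj h y : Aut h -> exists x, h x = y.
Proof. by move=> [g hg [_ ->]]; exact: map_surj. Qed.

Lemma type_aut_P h x : Aut h -> P (h x) = P x.
Proof.
have [hp _ _ _] := hwom.
by move=> [g hg [fg ->]]; apply/propext; exact: (type_aut hp).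
Qed.

Lemma definable_rel_invariant R : definable_rel A R -> invariant_rel Aut R.
Proof.
move=> hR h x y [g hg [fg ->]]; apply/propext.
have := definable_aut (cat_tup x y) hg fg hR.
by rewrite map_cat /= !tleft_cat !tright_cat.
Qed.

Lemma rel_definable2P R : rel_definable2 A (P `*` P) R ->
  exists2 S, definable_rel A S & forall x y, R (x, y) <-> [/\ P x, P y & S x y].
Proof.
move=> [Y hY ->]; exists (fun x y => Y (x, y)); first exact: definable2P.
by move=> x y; split=> [[? []]|[]].
Qed.

Lemma rel_definable2_invariant R : rel_definable2 A (P `*` P) R ->
  invariant_rel Aut (fun x y => R (x, y)).
Proof.
move=> /rel_definable2P [S hS RS] h x y hh; apply/propext.
by rewrite !RS !(type_aut_P _ hh) (definable_rel_invariant hS).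
Qed.

Lemma definable_components X : definable setT X ->
  finite_set (convex_component P lt X).
Proof.
have [_ _ _ fin] := hwom => hX.
have := fin (X `&` P) (ex_intro2 _ _ X hX erefl).
congr finite_set; apply/seteqP; split=> K0 [[KP cK] KX mK]; split=> //.
- by move=> x /KX [].
- move=> K' cK' K'X; apply: mK => // x K'x; split; first exact: K'X.
  by have [K'P _] := cK'; exact: K'P.
- by move=> x Kx; split; [exact: KX | exact: KP].
- by move=> K' cK' K'X; apply: mK => // x /K'X [].
Qed.

Lemma definable_finite_sections R : definable_rel A R -> finite_sections P lt R.
Proof.
move=> hR x _; apply: definable_components; apply: definable_section => //.
exact: definableS hR.
Qed.

Lemma rel_definable2_finite_sections R : rel_definable2 A (P `*` P) R ->
  finite_sections P lt (fun x y => R (x, y)).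
Proof.
move=> [Y hY eR] x Px; have [_ _ _ fin] := hwom; apply: fin.
exists (fun y => Y (x, y)).
  by apply: (@definable_section _ _ _ _ _ (fun x y => Y (x, y))) => //;
    exact: definableS (definable2P hY).
by apply/seteqP; split=> y; rewrite eR; [case=> ? [] | case].
Qed.

Lemma Eqv_convex E : Eqv A p E -> convex_equivalence P lt E.
Proof.
have [_ hlt dlt _] := hwom => -[hE dE].
apply: (invariant_equivalence_convex hlt type_aut_trans type_aut_P) => //.
- exact: rel_definable2_invariant.
- exact: rel_definable2_invariant.
- exact: rel_definable2_finite_sections.
Qed.

Lemma Eqv_comparable E F : Eqv A p E -> Eqv A p F -> E `<=` F \/ F `<=` E.
Proof.
have [_ hlt dlt _] := hwom => cE cF.
apply: (invariant_convex_comparable hlt type_aut_trans type_aut_P); try exact: Eqv_convex.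
- exact: rel_definable2_invariant.
- by case: cE => _; exact: rel_definable2_invariant.
- by case: cF => _; exact: rel_definable2_invariant.
Qed.

(** The definition of [reach] quantifies over [P], which is only type-definable. Compactness
    replaces [P] by an [A]-definable [Y] containing it, and homogeneity reduces the comparison on
    [P] to a single point [x0]. *)
Lemma refine_definable le E : definable_rel A le -> (forall x, P x -> le x x) ->
  convex_equivalence P lt E -> rel_definable2 A (P `*` P) E ->
  rel_definable2 A (P `*` P) (refine P lt le E).
Proof.
have [hp hlt dlt _] := hwom; have [ltP ltxx lttr ltot] := hlt.
move=> dle le_refl hE dE; have [[EP Er Es Et] _] := hE.
have [RE dRE REE] := rel_definable2P dE.
have [Rl dRl RlE] := rel_definable2P dlt.
case: (pselect (exists x0, P x0)) => [[x0 Px0]|nP]; last first.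
  exists setT; first by exists setT; [exact: definable_true | apply/seteqP; split].
  apply/seteqP; split=> -[x y]; first by move=> [/= Px]; case: nP; exists x.
  by move=> [_ [/= Px]]; case: nP; exists x.
pose X x w := RE x w /\ le w x.
have dX : definable_rel A X.
  apply: definable_and; first exact: dRE.
  by apply: (definable_rel_comp (R := le)) => //; renaming_tac.
have dX0 : definable setT (X x0) by apply: definable_section => //; exact: definableS dX.
(* [c] lies in the last convex component of [X x0]. *)
have [c [Pc Xc lastc]] : exists c, [/\ P c, X x0 c & forall y w, P y -> P w ->
    lt (c, y) -> lt (y, w) -> X x0 w -> X x0 y].
  apply: contrapT => h.
  have Xx0 : X x0 x0.
    by split; [have /REE [_ _] := Er _ Px0; exact | exact: le_refl].
  (* Without such a [c], the set [X x0] would be left and re-entered above each of its points. *)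
  apply: (alternates_forever hlt (definable_components dX0) _ Px0 Xx0) => c Pc Xc.
  apply: contrapT => h'; apply: h; exists c; split=> // y w Py Pw cy yw Xw.
  by apply: contrapT => nX; apply: h'; exists y, w.
pose B := entries x0 `|` (entries c `|` A).
have sB : small K B by do 2 apply: small_entries => //.
have AB : A `<=` B by move=> a Aa; right; right.
have Bx0 : tup_in B x0 by exact: tup_in_entries.
have Bc : tup_in B c by move=> s v; right; exact: tup_in_entries.
(* On [P] this says that [X x0] has no gap above [c]; compactness extends it to [Y]. *)
pose Z y w (_ : tp G) := Rl c y -> Rl y w -> X x0 w -> X x0 y.
have [||Y [dY PY hY]] := compactness hsat hp (Z := Z) sB AB.
- have dX0B : definable B (X x0) by apply: definable_section => //; exact: definableS dX.
  have dRcB : definable B (Rl c) by apply: definable_section => //; exact: definableS dRl.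
  apply: definable_imp.
    by apply: (definable_rename (X := Rl c)) => //; renaming_tac.
  apply: definable_imp.
    apply: (definable_rel_comp (R := Rl)); try renaming_tac.
    exact: definableS dRl.
  apply: definable_imp; apply: (definable_rename (X := X x0)) => //; renaming_tac.
- move=> y w _ Py Pw _ cy yw; apply: lastc => //; exact/RlE.
pose Phi x y := exists w, Y w /\ (y = w \/ Rl y w) /\ X x w.
have dPhi : definable_rel A Phi.
  apply: definable_ex; apply: definable_and.
    by apply: (definable_rename (X := Y)) => //; renaming_tac.
  apply: definable_and; last by apply: (definable_rel_comp (R := X)) => //; renaming_tac.
  apply: definable_or; last by apply: (definable_rel_comp (R := Rl)) => //; renaming_tac.
  by apply: definable_eq; renaming_tac.
have reachE x y : P x -> P y -> reach P lt le E x y <-> Phi x y.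
  move=> Px Py; have [h hh hx] := type_aut_trans Px Px0.
  have iR : reach P lt le E (h x) (h y) = reach P lt le E x y.
    apply: reach_invariant hh => //.
    - exact: type_aut_surj.
    - exact: type_aut_P.
    - exact: rel_definable2_invariant.
    - exact: definable_rel_invariant.
    - exact: rel_definable2_invariant.
  rewrite -iR -(definable_rel_invariant dPhi _ _ hh) hx.
  move: (h y) (type_aut_P y hh) => y'; rewrite (propext (_ : P y <-> True)) // => e.
  have {e}Py' : P y' by rewrite e.
  split=> [[w [Pw yw xw lwx]]|[w [Yw [yw Xw]]]].
    exists w; split; first exact: PY.
    split; last by split=> //; have /REE [] := xw.
    by case: yw => [|/RlE []]; [left | right].
  have reach_X v : P v -> X x0 v -> y' = v \/ lt (y', v) -> reach P lt le E x0 y'.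
    by move=> Pv [xv lv] yv; exists v; split=> //; apply/REE.
  (* The witness [w] lies only in [Y] and must be replaced by one in [P]: above [c] the point [y']
     itself is in [X x0], and up to [c] the point [c] serves. *)
  case: (ltot c y' Pc Py') => [cy|e|yc].
  - have /RlE [_ _ Rcy] := cy.
    case: yw => [e|yw]; first by apply: (reach_X y') => //; [rewrite e | left].
    apply: (reach_X y') => //; last by left.
    exact: (hY y' w y' (PY _ Py') Yw (PY _ Py')).
  - by apply: (reach_X c) => //; left; rewrite e.
  - by apply: (reach_X c) => //; right.
exists [set z | Phi z.1 z.2 /\ Phi z.2 z.1].
  apply: (definable_relP (R := fun x y => Phi x y /\ Phi y x)); apply: definable_and => //.
  by apply: (definable_rel_comp (R := Phi)) => //; renaming_tac.
apply/seteqP; split=> -[x y].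
  by move=> [/= Px Py /reachE h1 /reachE h2]; split=> //; split; [exact: h1 | exact: h2].
by move=> [/= [h1 h2] [/= Px Py]]; split=> //; exact/reachE.
Qed.

(** * A definable function from the type to a linear order *)

Section Function.
Variables (H : seq (Sorts L)) (D : set (tp H)) (ltD : set (tp H * tp H)).
Variable f : tp G -> tp H.
Hypothesis hD : definable A D.
Hypothesis hltD : definable2 A ltD.
Hypothesis hltD_lin : linear_order D ltD.
Hypothesis hfD : set_fun P D f.
Hypothesis hf : rel_definable2 A (P `*` D) (graph P f).

Local Notation leD d e := (ltD (d, e) \/ d = e).

(** Requiring [D d] in the formula keeps its values inside [D] even at points outside [P], as needed
    when the function is extended beyond [P]. *)
Lemma graph_formula : exists2 R : tp G -> tp H -> Prop, definable_rel A R &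
  (forall x d, R x d -> D d) /\ (forall x d, P x -> R x d <-> d = f x).
Proof.
have [Y dY e] := hf; exists (fun x d => Y (x, d) /\ D d).
  apply: definable_and; first exact: definable2P dY.
  by apply: (definable_rename (X := D)) => //; renaming_tac.
split=> [x d []//|x d Px].
have -> : (Y (x, d) /\ D d) = graph P f (x, d).
  by rewrite e; apply/propext; split=> [[? ?]|[? [_ ?]]].
by split=> [[]|].
Qed.

Lemma definable_leD : definable_rel A (fun d e => leD d e).
Proof.
apply: definable_or; last by apply: definable_eq; renaming_tac.
by apply: (definable_rel_comp (R := fun d e => ltD (d, e))); try renaming_tac; exact: definable2P.
Qed.

Lemma value_order_definable R : definable_rel A R ->
  definable_rel A (fun x y : tp G => exists d, R x d /\ exists e, R y e /\ leD d e).
Proof.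
move=> dR; apply: definable_ex; apply: definable_and.
  by apply: (definable_rel_comp (R := R)) => //; renaming_tac.
apply: definable_ex; apply: definable_and.
  by apply: (definable_rel_comp (R := R)) => //; renaming_tac.
by apply: (definable_rel_comp (R := fun d e => leD d e)); try renaming_tac; exact: definable_leD.
Qed.

Lemma value_order_formula : exists2 le : tp G -> tp G -> Prop, definable_rel A le &
  forall x y, P x -> P y -> le x y <-> leD (f x) (f y).
Proof.
have [R dR [RD RE]] := graph_formula.
exists (fun x y => exists d, R x d /\ exists e, R y e /\ leD d e).
  exact: value_order_definable.
move=> x y Px Py; split=> [[d [/RE -> // [e [/RE -> //]]]]|xy].
by exists (f x); split; [exact/RE | exists (f y); split; [exact/RE |]].
Qed.

Variables (lef : tp G -> tp G -> Prop).
Hypothesis dlef : definable_rel A lef.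
Hypothesis lefE : forall x y, P x -> P y -> lef x y <-> leD (f x) (f y).

Lemma lef_refl x : P x -> lef x x.
Proof. by move=> Px; apply/lefE => //; right. Qed.

Lemma lef_trans x y z : P x -> P y -> P z -> lef x y -> lef y z -> lef x z.
Proof.
move=> Px Py Pz /lefE h1 /lefE h2; apply/lefE => //.
by apply: (leD_trans hltD_lin (h1 _ _) (h2 _ _)).
Qed.

Lemma lef_total x y : P x -> P y -> lef x y \/ lef y x.
Proof.
move=> Px Py; case: (leD_total hltD_lin (hfD Px) (hfD Py)) => h.
  by left; apply/lefE.
by right; apply/lefE.
Qed.

Lemma lef_anti x y : P x -> P y -> lef x y -> lef y x -> f x = f y.
Proof.
have [_ ltxx lttr _] := hltD_lin.
move=> Px Py /lefE h1 /lefE h2; case: (h1 Px Py) (h2 Py Px) => // l1 [l2|//].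
by case: (ltxx (f x)); apply: lttr l2.
Qed.

Lemma level_Ker : level P lef = Ker P f.
Proof.
apply/seteqP; split=> -[x y] /= [Px Py]; first by move=> h1 h2; split=> //; exact: lef_anti.
by move=> e; split=> //; apply/lefE => //; right.
Qed.

Local Notation layer := (layer P lt Aut lef (rel_definable2 A (P `*` P))).

Lemma layers_function : (exists x y, [/\ P x, P y & f x <> f y]) ->
  exists Es, [/\ List.Forall layer Es, StronglySorted (fun E F => E `<` F) Es,
    ohead Es = Some (Ker P f) &
    forall x y, P x -> P y -> lt (x, y) ->
      if parity Es (x, y) then lef y x else lef x y].
Proof.
have [_ hlt dlt _] := hwom.
move=> [x [y [Px Py nxy]]]; rewrite -level_Ker.
have dge : definable_rel A (fun x y => lef y x).
  by apply: (definable_rel_comp (R := lef)) => //; renaming_tac.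
have dsigned b : definable_rel A (signed lef b) by case: b.
apply: (layers_exist hlt type_aut_trans type_aut_surj type_aut_P) => //.
- exact: rel_definable2_invariant.
- exact: lef_refl.
- exact: lef_trans.
- exact: lef_total.
- exact: definable_rel_invariant.
- exact: definable_finite_sections.
- exact: definable_finite_sections.
- by exists setT; [exists setT; [exact: definable_true | apply/seteqP; split] | rewrite setTI].
- move=> b E [hE _ _ _ dE]; apply: refine_definable => //.
  by case: b => z Pz; exact: lef_refl.
- case: (pselect (lef x y)) => [xy|nle]; last by exists x, y.
  by exists y, x; split=> // yx; apply: nxy; exact: lef_anti.
Qed.

Lemma layer_Eqv E : layer E -> Eqv A p E.
Proof. by case=> -[]. Qed.

Lemma Eqv_sym E : Eqv A p E -> symmetric_rel E.
Proof. by case=> -[]. Qed.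

Lemma Eqv_pair E F : Eqv A p E -> Eqv A p F -> ~ E `<=` F ->
  exists x y, [/\ lt (x, y), E (x, y) & ~ F (x, y)].
Proof.
have [_ hlt _ _] := hwom => -[eE _] [eF _] nEF.
by have [x [y [_ _ xy Exy nF]]] := not_sub_lt hlt eE eF nEF; exists x, y.
Qed.

(** Outside [Ker P f] two values differ, so the direction of their inequality determines the parity
    for both chains, and [chain_unique] applies above the kernel. *)
Lemma increasing_unique Es Es' :
  List.Forall (Eqv A p) Es -> List.Forall (Eqv A p) Es' ->
  StronglySorted (fun E F => E `<` F) Es -> StronglySorted (fun E F => E `<` F) Es' ->
  ohead Es = Some (Ker P f) -> ohead Es' = Some (Ker P f) ->
  increasing P (flips lt Es) ltD f -> increasing P (flips lt Es') ltD f -> Es = Es'.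
Proof.
have [_ hlt _ _] := hwom; have [ltP _ _ _] := hlt; have [_ ltxx lttr _] := hltD_lin.
case: Es Es' => [|E Es] [|E' Es'] // cE cE' sE sE' [eE] [eE']; subst E E'.
have sym Fs : List.Forall (Eqv A p) Fs -> List.Forall (@symmetric_rel _) Fs.
  by apply: List.Forall_impl; exact: Eqv_sym.
move=> /(increasing_parity _ _ _ _ (sym _ cE)) h; move=> /(increasing_parity _ _ _ _ (sym _ cE')) h'.
congr cons; apply: (chain_unique Eqv_comparable Eqv_pair (conj cE sE) (conj cE' sE')).
move=> x y xy nK; have [/= Px Py] := ltP _ xy.
have nf : f x <> f y by move=> e; apply: nK.
have := h x y Px Py xy; have := h' x y Px Py xy; rewrite !parity_skip //.
have contra : ltD (f x, f y) -> ltD (f y, f x) -> False.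
  by move=> h1 h2; apply: (ltxx (f x)); apply: lttr h2.
case: (parity Es _); case: (parity Es' _) => // -[l1|e1] [l2|e2]; exfalso;
  by [apply: contra l1 l2 | apply: contra l2 l1 | apply: nf | apply/nf/esym].
Qed.

(** The hull taken over [P] itself need not be definable. Compactness extends [f] and [E], with all
    the properties the hull requires, to an [A]-definable [X] containing [P], and the hull is taken
    there. *)
Lemma hull_definable E : layer E -> exists F : set (tp H * tp H),
  [/\ definable2 A F, convex_equivalence D ltD F &
      forall x y, P x -> P y -> F (f x, f y) <-> E (x, y)].
Proof.
have [hp hlt dlt _] := hwom.
move=> [[[EP Er Es Et] _] _ kE cE dE].
have [RE dRE REE] := rel_definable2P dE.
have [R dR [RD RfE]] := graph_formula.
pose single u := exists d, R u d /\ ~ exists e, R u e /\ ~ d = e.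
have dsingle : definable A single.
  apply: definable_ex; apply: definable_and.
    by apply: (definable_rel_comp (R := R)) => //; renaming_tac.
  apply: definable_not; apply: definable_ex; apply: definable_and.
    by apply: (definable_rel_comp (R := R)) => //; renaming_tac.
  by apply: definable_not; apply: definable_eq; renaming_tac.
pose leR u v := exists d, R u d /\ exists e, R v e /\ leD d e.
have dleR : definable_rel A leR by exact: value_order_definable.
(* All conditions are bundled into one relation, so that a single [X] satisfies them
   simultaneously. *)
pose Z u z v := single u /\ RE u u /\ (RE u z -> RE z u) /\ (RE u z -> RE z v -> RE u v) /\
  (leR u z -> leR z v -> RE u v -> RE u z).
have [||X [dX PX hX]] := compactness hsat hp (Z := Z) hA (fun x h => h).
- have dREc m n := @definable_rel_comp _ _ A _ _ (G ++ (G ++ G)) RE m n.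
  have dleRc m n := @definable_rel_comp _ _ A _ _ (G ++ (G ++ G)) leR m n.
  apply: definable_and; first by apply: (definable_rename (X := single)) => //; renaming_tac.
  apply: definable_and; first by apply: dREc => //; renaming_tac.
  apply: definable_and; first by apply: definable_imp; apply: dREc => //; renaming_tac.
  apply: definable_and.
    by apply: definable_imp; [|apply: definable_imp]; apply: dREc => //; renaming_tac.
  apply: definable_imp; first by apply: dleRc => //; renaming_tac.
  apply: definable_imp; first by apply: dleRc => //; renaming_tac.
  by apply: definable_imp; apply: dREc => //; renaming_tac.
- move=> u z v Pu Pz Pv.
  have RE' a b : P a -> P b -> RE a b <-> E (a, b) by move=> Pa Pb; rewrite REE; split=> [|[]].
  have leR' a b : P a -> P b -> leR a b -> lef a b.
    move=> Pa Pb [d [/(RfE _ _ Pa) -> [e [/(RfE _ _ Pb) -> h]]]]; exact/lefE.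
  split.
    exists (f u); split; first exact/RfE.
    by move=> [e [/(RfE _ _ Pu) ->]].
  rewrite !RE' //; split; first exact: Er.
  split; first exact: Es.
  split; first by move=> h1 h2; exact: Et h2.
  by move=> /leR' h1 /leR' h2; apply: cE => //; [exact: h1 | exact: h2].
(* [g] is the function whose graph on [X] is [R]. It agrees with [f] on [P], and its values outside
   [X] are arbitrary. *)
have /choice [g hg] u : exists d, X u -> forall e, R u e <-> e = d.
  case: (pselect (X u)) => [Xu|nX]; last by exists (f u).
  have [[d [Rd nd]] _] := hX u u u Xu Xu Xu.
  exists d => _ e; split=> [Re|->//]; apply: contrapT => ne; apply: nd; exists e.
  by split=> // de; apply: ne.
have gD u : X u -> D (g u) by move=> Xu; apply: (RD u); apply/hg.
have Xr u : X u -> RE u u by move=> Xu; have [_ []] := hX u u u Xu Xu Xu.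
have Xs u v : X u -> X v -> RE u v -> RE v u.
  by move=> Xu Xv; have [_ [_ []]] := hX u v u Xu Xv Xu.
have Xt u v w : X u -> X v -> X w -> RE u v -> RE v w -> RE u w.
  by move=> Xu Xv Xw; have [_ [_ [_ []]]] := hX u v w Xu Xv Xw.
have Xc u z v : X u -> X z -> X v -> leD (g u) (g z) -> leD (g z) (g v) -> RE u v -> RE u z.
  move=> Xu Xz Xv uz zv; have [_ [_ [_ [_]]]] := hX u z v Xu Xz Xv; apply.
    by exists (g u); split; [exact/hg | exists (g z); split; [exact/hg|]].
  by exists (g z); split; [exact/hg | exists (g v); split; [exact/hg|]].
exists (hull D ltD X RE g); split.
- pose low u d := exists e, R u e /\ leD e d.
  pose high u d := exists e, R u e /\ leD d e.
  have dlow : definable_rel A low.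
    apply: definable_ex; apply: definable_and.
      by apply: (definable_rel_comp (R := R)) => //; renaming_tac.
    by apply: (definable_rel_comp (R := fun d e => leD d e)); try renaming_tac; exact: definable_leD.
  have dhigh : definable_rel A high.
    apply: definable_ex; apply: definable_and.
      by apply: (definable_rel_comp (R := R)) => //; renaming_tac.
    by apply: (definable_rel_comp (R := fun d e => leD d e)); try renaming_tac; exact: definable_leD.
  have lowE u d : X u -> low u d <-> leD (g u) d.
    move=> Xu; split=> [[e [/(hg _ Xu) ->]] //|h]; exists (g u); split=> //; exact/hg.
  have highE u d : X u -> high u d <-> leD d (g u).
    move=> Xu; split=> [[e [/(hg _ Xu) ->]] //|h]; exists (g u); split=> //; exact/hg.
  (* The choice function [g] is not itself a formula; on [X] its comparisons are expressed through
     [R] by [low] and [high]. *)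
  have -> : hull D ltD X RE g = [set z | D z.1 /\ D z.2 /\ (z.1 = z.2 \/ exists u, exists v,
      X u /\ X v /\ RE u v /\ low u z.1 /\ low u z.2 /\ high v z.1 /\ high v z.2)].
    apply/seteqP; split=> -[d e] /=.
      move=> [Dd De de]; split=> //; split=> //; case: de => [|[u [v]]]; first by left.
      move=> [Xu Xv uv [ud ue] [dv ev]]; right; exists u, v; do ![split=> //].
      - exact/lowE.
      - exact/lowE.
      - exact/highE.
      - exact/highE.
    move=> [Dd [De de]]; split=> //; case: de => [|[u [v]]]; first by left.
    move=> [Xu [Xv [uv [ud [ue [dv ev]]]]]]; right; exists u, v; split=> //.
      by split; apply/lowE.
    by split; apply/highE.
  apply: (definable_relP (R := fun d e => D d /\ D e /\ (d = e \/ exists u, exists v,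
      X u /\ X v /\ RE u v /\ low u d /\ low u e /\ high v d /\ high v e))).
  apply: definable_and; first by apply: (definable_rename (X := D)) => //; renaming_tac.
  apply: definable_and; first by apply: (definable_rename (X := D)) => //; renaming_tac.
  apply: definable_or; first by apply: definable_eq; renaming_tac.
  do 2 apply: definable_ex.
  apply: definable_and; first by apply: (definable_rename (X := X)) => //; renaming_tac.
  apply: definable_and; first by apply: (definable_rename (X := X)) => //; renaming_tac.
  apply: definable_and; first by apply: (definable_rel_comp (R := RE)) => //; renaming_tac.
  apply: definable_and; first by apply: (definable_rel_comp (R := low)) => //; renaming_tac.
  apply: definable_and; first by apply: (definable_rel_comp (R := low)) => //; renaming_tac.
  apply: definable_and; by apply: (definable_rel_comp (R := high)) => //; renaming_tac.
- exact: hull_convex.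
- move=> x y Px Py.
  have gf z : P z -> g z = f z.
    by move=> Pz; apply/(RfE _ _ Pz); apply/(hg _ (PX _ Pz)).
  rewrite -(gf x Px) -(gf y Py) (hull_image hltD_lin) //; try exact: PX.
    by rewrite REE; split=> [|[]].
  rewrite !gf // => e; have /REE [] // : E (x, y).
  by apply: kE => //; apply/lefE => //; right.
Qed.

Lemma convex_equivalenceI (F F' : set (tp H * tp H)) :
  convex_equivalence D ltD F -> convex_equivalence D ltD F' ->
  convex_equivalence D ltD (F `&` F').
Proof.
move=> [[FD Fr Fs Ft] cF] [[_ Fr' Fs' Ft'] cF']; split.
  split.
  - by move=> z [/FD].
  - by move=> x Dx; split; [exact: Fr | exact: Fr'].
  - by move=> x y [xy xy']; split; [exact: Fs | exact: Fs'].
  - by move=> x y z [xy xy'] [yz yz']; split; [exact: Ft yz | exact: Ft' yz'].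
move=> x Dx; have [_ h] := cF x Dx; have [_ h'] := cF' x Dx.
split=> [y /= [/FD []]//|a z b /= [xa xa'] [xb xb'] Dz az zb].
by split; [apply: (h a z b) | apply: (h' a z b)].
Qed.

Lemma definable2I (F F' : set (tp H * tp H)) :
  definable2 A F -> definable2 A F' -> definable2 A (F `&` F').
Proof.
move=> /definable2P dF /definable2P dF'.
have := definable_relP (R := fun d e => F (d, e) /\ F' (d, e)) (definable_and dF dF').
by congr definable2; apply/seteqP; split=> -[].
Qed.

(** Hulls built on different sets [X] need not be nested, so each is intersected with its successor.
    On values of [f] this changes nothing, because [E] is contained in the next relation. *)
Lemma hull_sequence Es : List.Forall layer Es -> StronglySorted (fun E F => E `<` F) Es ->
  exists Fs : seq (set (tp H * tp H)),
   [/\ size Fs = size Es,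
       List.Forall (fun F => definable2 A F /\ convex_equivalence D ltD F) Fs,
       StronglySorted (fun F F' => F `<=` F') Fs &
       List.Forall2 (fun E F => forall x y, P x -> P y -> F (f x, f y) <-> E (x, y)) Es Fs].
Proof.
elim: Es => [|E Es IH]; first by exists [::]; split=> //; constructor.
move=> /List.Forall_cons_iff [lE lEs] hs; have [sEs ltEs] := StronglySorted_inv hs.
have [Fs [sz dFs sFs EF]] := IH lEs sEs; have [F [dF cF FE]] := hull_definable lE.
case: Es Fs sz {IH hs} lEs sEs ltEs dFs sFs EF => [|E1 Es] [|F1 Fs] // sz lEs sEs ltEs dFs sFs EF.
  by exists [:: F]; split=> //; do 2 (constructor=> //).
exists ((F `&` F1) :: F1 :: Fs).
have /List.Forall_cons_iff [[dF1 cF1] _] := dFs.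
have [_ F1Fs] := StronglySorted_inv sFs.
have hEF1 : forall x y, P x -> P y -> F1 (f x, f y) <-> E1 (x, y) by inversion EF.
split.
- by move: sz => /= [->].
- constructor=> //; split; [exact: definable2I | exact: convex_equivalenceI].
- constructor=> //; constructor; first by move=> z [].
  by apply: List.Forall_impl F1Fs => F2 F12 z [_ /F12].
- constructor=> // x y Px Py; have /List.Forall_cons_iff [[EE1 _] _] := ltEs.
  by rewrite /setI /= FE // hEF1 //; split=> [[]|xy] //; split=> //; exact: EE1.
Qed.

Lemma parity_transfer Es Fs x y :
  List.Forall2 (fun E F => forall x y, P x -> P y -> F (f x, f y) <-> E (x, y)) Es Fs ->
  P x -> P y -> parity Fs (f x, f y) = parity Es (x, y).
Proof.
by move=> EF Px Py; elim: EF => //= E F Es' Fs' h _ ->; rewrite (propext (h x y Px Py)).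
Qed.

End Function.
End TypeOrder.

(** * Existence, uniqueness and transfer of the flips to the range *)

Theorem theorem1 (L : signature) (T : theory L) (hT : complete_theory T)
    (K : Type) (C : structure L) (hC : monster K T C)
    (A : set (elt C)) (hA : small K A)
    (G : seq (Sorts L)) (p : set (pformula C G)) (ltp : set (tup C G * tup C G))
    (hp : weakly_ominimal_pair A p ltp)
    (H : seq (Sorts L)) (D : set (tup C H)) (ltD : set (tup C H * tup C H))
    (hD : definable A D) (hltD : definable2 A ltD) (hltD_lin : linear_order D ltD)
    (f : tup C G -> tup C H)
    (hfD : set_fun (realizations p) D f)
    (hf : rel_definable2 A (realizations p `*` D) (graph (realizations p) f))
    (hf_nc : exists x y, [/\ realizations p x, realizations p y & f x <> f y]) :
  exists Es : seq (set (tup C G * tup C G)),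
    unique (fun Es' : seq (set (tup C G * tup C G)) =>
      [/\ List.Forall (Eqv A p) Es',
          StronglySorted (fun E E' => E `<` E') Es',
          ohead Es' = Some (Ker (realizations p) f)
        & increasing (realizations p) (flips ltp Es') ltD f]) Es /\
    exists Fs : seq (set (tup C H * tup C H)),
      [/\ size Fs = size Es,
          List.Forall (fun F => definable2 A F /\ convex_equivalence D ltD F) Fs,
          StronglySorted (fun F F' => F `<=` F') Fs
        & increasing (realizations p) ltp (flips ltD Fs) f].
Proof.
have hK := monster_infinite hC; have [_ _ hsat hhom] := hC.
have [_ hlt _ _] := hp.
have [le dle leE] := value_order_formula hD hltD hf.
have [Es [lEs sEs hEs pEs]] :=
  layers_function hK hsat hhom hA hp hltD_lin hfD dle leE hf_nc.
have eEs : List.Forall (Eqv A p) Es by apply: List.Forall_impl lEs; exact: layer_Eqv.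
have symEs : List.Forall (@symmetric_rel _) Es by apply: List.Forall_impl eEs; exact: Eqv_sym.
have signs x y : realizations p x -> realizations p y -> ltp (x, y) ->
    if parity Es (x, y) then ltD (f y, f x) \/ f y = f x else ltD (f x, f y) \/ f x = f y.
  by move=> Px Py xy; have := pEs x y Px Py xy; case: ifP => _; rewrite leE.
have incEs : increasing (realizations p) (flips ltp Es) ltD f.
  exact/(increasing_parity _ _ _ _ symEs).
exists Es; split.
  split=> // Es' [eEs' sEs' hEs' incEs'].
  exact: (increasing_unique hK hhom hA hp hltD_lin eEs eEs' sEs sEs' hEs hEs' incEs incEs').
have [Fs [szFs dFs sFs EF]] := hull_sequence hsat hA hp hD hltD hltD_lin hf leE lEs sEs.
exists Fs; split=> // x y Px Py xy.
have symFs : List.Forall (@symmetric_rel _) Fs.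
  by apply: List.Forall_impl dFs => F [_ [[_ _ Fsym _] _]].
suff : flips ltD Fs (f x, f y) \/ f x = f y by [].
(* The pair of values lies in as many members of [Fs] as [(x, y)] does in [Es], so [ltD] is reversed
   there exactly when [f] reverses the pair. *)
have := signs x y Px Py xy; rewrite (flips_parity _ _ _ symFs) (parity_transfer EF Px Py).
by case: ifP => // _ [|->]; [left | right].
Qed.
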